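(* Let $G$ be a connected graph on $n$ vertices. Then, for every real $a\ge 0$ and every real number $p\ge 2$, $$\sum_{i=1}^n \bigl(\lambda_i(L(G))-a\bigr)_+^p\ge \sum_{i=1}^n \bigl(\lambda_i(L(P_n))-a\bigr)_+^p$$ and $$\sum_{i=1}^n \bigl(\lambda_i(Q(G))-a\bigr)_+^p\ge \sum_{i=1}^n \bigl(\lambda_i(Q(P_n))-a\bigr)_+^p.$$
   Context: All graphs are finite, simple, undirected and unweighted. For real $x$, $x_+=\max\{x,0\}$ and $x_+^p=(x_+)^p$. For a graph $G$, $A(G)$ is the adjacency matrix, $D(G)$ the diagonal matrix of vertex degrees, $L(G)=D(G)-A(G)$ the Laplacian matrix and $Q(G)=D(G)+A(G)$ the signless Laplacian matrix. For a real symmetric matrix $M$, $\lambda_1(M)\ge\lambda_2(M)\ge\cdots$ are its eigenvalues repeated with multiplicity. $P_n$ denotes the path on $n$ vertices ($P_1$ is a single vertex). *)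

(* Defs.v *)
From HB Require Import structures.
From mathcomp Require Import all_boot all_order all_algebra.
From mathcomp Require Import polyrcf.
From mathcomp Require complex.
From mathcomp Require Import reals exp.

Set Implicit Arguments.
Unset Strict Implicit.
Unset Printing Implicit Defensive.

Import Order.TTheory GRing.Theory Num.Theory.
Local Open Scope ring_scope.

Record graph (n : nat) := Graph {
  adj :> rel 'I_n;
  adj_sym : symmetric adj;
  adj_irr : irreflexive adj
}.

Definition connected n (G : graph n) : Prop :=
  (0 < n)%N /\ forall i j : 'I_n, connect G i j.

Definition path_rel n : rel 'I_n :=
  [rel i j : 'I_n | (j == i.+1 :> nat) || (i == j.+1 :> nat)].

Lemma path_rel_sym n : symmetric (@path_rel n).
Proof. by move=> i j; rewrite /path_rel /= orbC. Qed.

Lemma path_rel_irr n : irreflexive (@path_rel n).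
Proof. by move=> i; rewrite /path_rel /= orbb eqn_leq ltnn andbF. Qed.

Definition path_graph n : graph n := Graph (@path_rel_sym n) (@path_rel_irr n).

Definition degree n (G : graph n) (i : 'I_n) : nat := #|[set j | G i j]|.

Section GraphMatrices.
Variables (R : pzRingType) (n : nat) (G : graph n).

Definition adjacency_mx : 'M[R]_n := \matrix_(i, j) (G i j)%:R.

Definition degree_mx : 'M[R]_n := diag_mx (\row_i (degree G i)%:R).

Definition laplacian : 'M[R]_n := degree_mx - adjacency_mx.

Definition signless_laplacian : 'M[R]_n := degree_mx + adjacency_mx.

End GraphMatrices.

Section Spectrum.
Import complex.
Variable R : rcfType.

(* The real eigenvalues in nonincreasing order, each repeated according to its
   multiplicity as a root of the characteristic polynomial. For a symmetric
   matrix these are all the eigenvalues, see spectrum_symmetric. *)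
Definition spectrum n (M : 'M[R]_n) : seq R :=
  sort >=%O (flatten [seq nseq (mup x (char_poly M)) x
                         | x <- rootsR (char_poly M)]).

(* Indexed from 0: lambda M i is the (i+1)-st largest eigenvalue. *)
Definition lambda n (M : 'M[R]_n) (i : 'I_n) : R := (spectrum M)`_i.

Lemma spectrum_sorted n (M : 'M[R]_n) : sorted >=%O (spectrum M).
Proof. by apply: sort_sorted => x y; rewrite le_total. Qed.

Lemma mup_prod_XsubC (s : seq R) x :
  mup x (\prod_(y <- s) ('X - y%:P)) = count_mem x s.
Proof.
elim: s => [|y s IHs]; first by rewrite big_nil mupNroot // root1.
rewrite big_cons mupM ?polyXsubC_eq0 ?IHs //=; last first.
  by rewrite monic_neq0 // monic_prod_XsubC.
by have := mup_XsubCX 1 x y; rewrite expr1 => ->; case: eqP.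
Qed.

Lemma spectrum_perm n (M : 'M[R]_n) (s : seq R) :
  char_poly M = \prod_(x <- s) ('X - x%:P) -> perm_eq (spectrum M) s.
Proof.
move=> Ms; rewrite /spectrum perm_sort.
have ->: [seq nseq (mup x (char_poly M)) x | x <- rootsR (char_poly M)] =
         [seq nseq (count_mem x s) x | x <- rootsR (char_poly M)].
  by apply: eq_map => x; rewrite Ms mup_prod_XsubC.
apply: perm_trans (perm_count_undup s).
apply/perm_flatten/perm_map/uniq_perm; rewrite ?uniq_roots ?undup_uniq //.
have p_neq0 : char_poly M != 0 by rewrite monic_neq0 // char_poly_monic.
by move=> x; rewrite mem_undup -roots_on_rootsR //= Ms root_prod_XsubC.
Qed.

Lemma char_poly_split n (M : 'M[R]_n) : M^T = M ->
  exists2 s : seq R, size s = n & char_poly M = \prod_(x <- s) ('X - x%:P).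
Proof.
pose toC : {rmorphism R -> complex R} := real_complex R.
move=> Msym; pose A : 'M[complex R]_n := map_mx toC M.
have Aherm : A \is hermsymmx.
  apply: realsym_hermsym.
    apply/is_hermitianmxP; rewrite expr0 scale1r map_mx_id //.
    by rewrite map_trmx Msym.
  by apply/mxOverP => i j; rewrite mxE; apply/complex_realP; exists (M i j).
have /hermitian_normalmx/orthomx_spectralP := Aherm.
set P := spectralmx A; set d := spectral_diag A => AE.
have dreal i : exists x, d 0 i == toC x.
  have /mxOverP/(_ 0 i)/complex_realP[x ->] := hermitian_spectral_diag_real Aherm.
  by exists x.
exists [seq xchoose (dreal i) | i : 'I_n]; first by rewrite size_map size_enum_ord.
apply: (map_poly_inj toC); rewrite map_char_poly -/A.
have Punit : P \in unitmx by apply: spectral_unit.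
have -> : char_poly A = char_poly (diag_mx d).
  have PVP : map_mx polyC (invmx P) *m map_mx polyC P = 1%:M.
    by rewrite -map_mxM mulVmx // map_mx1.
  rewrite {1}AE /char_poly /char_poly_mx !map_mxM.
  have {1}-> : 'X%:M = map_mx polyC (invmx P) *m 'X%:M *m map_mx polyC P.
    by rewrite scalar_mxC -mulmxA PVP mulmx1.
  by rewrite -mulmxBl -mulmxBr !det_mulmx mulrAC -det_mulmx PVP det1 mul1r.
rewrite char_poly_trig ?diag_mx_is_trig // big_map big_enum /= rmorph_prod /=.
apply: eq_bigr => i _; rewrite !mxE eqxx mulr1n rmorphB /= map_polyX map_polyC /=.
congr ('X - _%:P); exact/eqP/(xchooseP (dreal i)).
Qed.

Lemma spectrum_symmetric n (M : 'M[R]_n) : M^T = M ->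
  size (spectrum M) = n /\ char_poly M = \prod_(x <- spectrum M) ('X - x%:P).
Proof.
move=> /char_poly_split[s sn Ms]; have ps := spectrum_perm Ms.
by rewrite (perm_size ps) sn (perm_big _ ps) Ms.
Qed.

End Spectrum.

Definition pos_pow (R : realType) (x p : R) : R := powR (Num.max x 0) p.

Lemma laplacian_sym (R : pzRingType) n (G : graph n) :
  (laplacian R G)^T = laplacian R G.
Proof.
rewrite /laplacian linearB /= tr_diag_mx; congr (_ - _).
by apply/matrixP => i j; rewrite !mxE adj_sym.
Qed.

Lemma signless_laplacian_sym (R : pzRingType) n (G : graph n) :
  (signless_laplacian R G)^T = signless_laplacian R G.
Proof.
rewrite /signless_laplacian linearD /= tr_diag_mx; congr (_ + _).
by apply/matrixP => i j; rewrite !mxE adj_sym.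
Qed.

(* Main.v *)
Require Import Defs.
From HB Require Import structures.
From mathcomp Require Import all_boot all_order all_algebra.
From mathcomp Require Import fingroup perm.
From mathcomp Require Import reals exp.
From mathcomp Require Import ring lra.

Set Implicit Arguments.
Unset Strict Implicit.
Unset Printing Implicit Defensive.

Import Order.TTheory GRing.Theory Num.Theory.
Local Open Scope ring_scope.

(** Write [Psi M] for the sum of [f] over the eigenvalues of a symmetric matrix
    [M], where [f x = (x - a)_+ ^ p]. Besides being convex and nondecreasing,
    [f] has a convex derivative [f'], because [p >= 2]; the whole proof rests on
    these three properties. The two matrices are [D + sg A] with [sg = -1] and
    [sg = 1], and both cases are treated at once: an edge [ab] contributes the
    rank-one matrix of the vector [e_a + sg e_b].

    The graph is turned into a path by steps that do not increase [Psi]. If an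
    edge lies on a cycle, delete it: a positive semidefinite summand disappears.
    If every edge is a bridge and [q_0, ..., q_m] is a path, let [q_i] be its
    first vertex with a neighbour [h] other than the two path neighbours, and
    replace the edge [h q_i] by [h q_0]. The path then grows by [h]. If there is
    no such [q_i], the graph is the path (spectral_sum_path_le).

    That moving the branch at [h] does not increase [Psi] has two parts. Let [M]
    be the matrix of the graph without the edge [h q_i].

    The analytic part (spectral_sum_dominance): [Psi (M + u^T u)] depends on [u]
    only through its spectral measure with respect to [M], and grows when mass
    of this measure moves to larger eigenvalues. Indeed a coupling of the two
    measures presents both perturbed matrices as [S + b^T b] with the same [b]
    and diagonal [S' <= S]. Raising a diagonal entry [k] of [N] changes [Psi N]
    at the rate [f'(N)_kk], which by Jensen's inequality for [f'] is at least
    [f'(N_kk)], and by the convexity of [f] this is at least the growth rate of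
    the sum of [f] over the entries of [S] (spectral_sum_add_diag,
    spectral_sum_shift_rank_one).

    The combinatorial part (end_tail_le): for a path with free end [q_0] whose
    vertices before [q_m] have no other neighbours, the spectral measure of
    [q_0] is dominated by that of [q_m]. The alternating sums [s_k] of the basis
    vectors along the path satisfy [M s_k = e_k + sg e_(k+1)], so in an
    eigenvector of eigenvalue [x] the squared coordinates telescope:
    [e_m^2 - e_0^2 = sg x s_m s_(m-1)]. Expanding the [s_k] in the eigenvectors
    of the adjacency matrix of a path turns this into a sum of terms
    [x (x - mu_i) alpha_i(x)^2], and for each [i] orthogonality makes the total
    over all eigenvalues of [M] vanish. Hence every upper tail is nonnegative.
    The vertex [h] contributes equally before and after the move, as it lies in
    another component of the graph of [M]. *)

(** * The real spectral theorem *)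

Section SpectralTheorem.
Variable R : rcfType.

Lemma dotmxE n (u v : 'rV[R]_n) : (u *m v^T) 0 0 = \sum_i u 0 i * v 0 i.
Proof. by rewrite mxE; apply: eq_bigr => i _; rewrite mxE. Qed.

Lemma dotmx_ge0 n (v : 'rV[R]_n) : 0 <= (v *m v^T) 0 0.
Proof. by rewrite dotmxE sumr_ge0 // => i _; rewrite -expr2 sqr_ge0. Qed.

Lemma dotmx_eq0 n (v : 'rV[R]_n) : (v *m v^T) 0 0 = 0 -> v = 0.
Proof.
rewrite dotmxE => /psumr_eq0P v0; apply/rowP => i; rewrite mxE.
have /eqP : v 0 i * v 0 i = 0 by apply: v0 => // j _; rewrite -expr2 sqr_ge0.
by rewrite mulf_eq0 orbb => /eqP.
Qed.

Lemma symmetric_unit_eigenvector n (M : 'M[R]_n.+1) : M^T = M ->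
  exists (a : R) (v : 'rV[R]_n.+1), v *m M = a *: v /\ v *m v^T = 1%:M.
Proof.
move=> Msym; have [[//|a s] _ Ms] := char_poly_split Msym.
have /eigenvalueP[v vM v0] : eigenvalue M a.
  by rewrite eigenvalue_root_char Ms root_prod_XsubC mem_head.
pose c := (v *m v^T) 0 0.
have c_gt0 : 0 < c.
  by rewrite lt_def dotmx_ge0 andbT; apply: contra_neq v0; apply: dotmx_eq0.
exists a, ((Num.sqrt c)^-1 *: v); split.
  by rewrite -scalemxAl vM !scalerA mulrC.
rewrite linearZ /= -scalemxAl -scalemxAr scalerA [v *m _]mx11_scalar -/c.
by rewrite -invfM -expr2 sqr_sqrtr ?ltW // scale_scalar_mx mulVf // gt_eqF.
Qed.

(** A Householder reflection carries the first basis vector to any unit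
    vector. *)
Lemma orthogonal_first_row n (v : 'rV[R]_n.+1) : v *m v^T = 1%:M ->
  exists H : 'M[R]_n.+1, H *m H^T = 1%:M /\ delta_mx 0 0 *m H = v.
Proof.
move=> v1; pose e : 'rV[R]_n.+1 := delta_mx 0 0.
have [w wE] : exists w, w = v - e by exists (v - e).
have e1 : e *m e^T = 1%:M.
  by rewrite trmx_delta mul_delta_mx; apply/matrixP => i j; rewrite !mxE !ord1.
have [w0|w0] := eqVneq w 0.
  exists 1%:M; split; first by rewrite trmx1 mulmx1.
  by rewrite mulmx1 -/e; apply/eqP; rewrite eq_sym -subr_eq0 -wE w0.
pose c := (w *m w^T) 0 0.
have wwE : w *m w^T = c%:M by exact: mx11_scalar.
have c0 : c != 0 by apply: contra_neq w0; apply: dotmx_eq0.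
have ewE : e *m w^T = (- c / 2)%:M.
  have -> : e *m w^T = - ((w *m w^T) 0 0 / 2)%:M; last first.
    by rewrite -/c mulNr rmorphN.
  rewrite wE linearB /= !mulmxBl !mulmxBr e1 v1.
  have -> : v *m e^T = e *m v^T.
    by rewrite [RHS]mx11_scalar [LHS]mx11_scalar !dotmxE;
      congr (_%:M); apply: eq_bigr => i _; rewrite mulrC.
  rewrite [e *m v^T]mx11_scalar; set b := (_ 0 0).
  apply/matrixP => i j; rewrite !mxE !ord1 /= !mulr1n. by field.
exists (1%:M - (2 / c) *: (w^T *m w)); split.
  rewrite [(_ - _)^T]linearB /= trmx1 [(_ *: _)^T]linearZ /= trmx_mul  trmxK.
  have PP : (w^T *m w) *m (w^T *m w) = c *: (w^T *m w).
    by rewrite mulmxA -(mulmxA w^T) wwE mul_mx_scalar -scalemxAl.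
  rewrite mulmxBl !mulmxBr !mul1mx mulmx1 -scalemxAl -scalemxAr PP !scalerA.
  have -> : 2 / c * (2 / c) * c = 2 / c + 2 / c by field; exact: c0.
  by rewrite scalerDl opprB addrK subrK.
rewrite mulmxBr mulmx1 -scalemxAr mulmxA -/e ewE mul_scalar_mx scalerA.
have -> : 2 / c * (- c / 2) = -1 by field; exact: c0.
by rewrite scaleN1r opprK wE addrC subrK.
Qed.

(** The real spectral theorem, by deflation: after an orthogonal change of
    basis that makes a unit eigenvector the first basis vector, a symmetric
    matrix is block diagonal. *)
Lemma symmetric_orthogonal_diagonalization n (M : 'M[R]_n) : M^T = M ->
  exists (U : 'M[R]_n) (d : 'rV[R]_n),
    U *m U^T = 1%:M /\ M = U^T *m diag_mx d *m U.
Proof.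
elim: n M => [|n IHn] M Msym.
  by exists 1%:M, 0; split; apply/matrixP => -[].
have [a [v [vM v1]]] := symmetric_unit_eigenvector Msym.
have [H [HH eH]] := orthogonal_first_row v1.
have HTH := mulmx1C HH.
pose e : 'rV[R]_n.+1 := delta_mx 0 0.
pose M1 : 'M[R]_(1 + n) := H *m M *m H^T.
have M1sym : M1^T = M1 by rewrite /M1 !trmx_mul trmxK Msym mulmxA.
have eM1 : e *m M1 = a *: e.
  by rewrite /M1 !mulmxA eH vM -scalemxAl -eH -mulmxA HH mulmx1.
have M1_0 j : M1 0 j = a * (j == 0)%:R.
  have /rowP/(_ j) := eM1; rewrite -rowE mxE => ->.
  by rewrite !mxE eqxx.
have M1ur : ursubmx M1 = 0.
  apply/matrixP => i j; rewrite [LHS]mxE [LHS]mxE [RHS]mxE !ord1.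
  have -> : lshift n (0 : 'I_1) = ord0 by apply/val_inj.
  by apply: etrans (M1_0 _) _; rewrite mulr0.
have M1dl : dlsubmx M1 = 0 by rewrite -M1sym -trmx_ursub M1ur trmx0.
have [U [d [UU M'E]]] : exists (U : 'M[R]_n) (d : 'rV[R]_n),
    U *m U^T = 1%:M /\ drsubmx M1 = U^T *m diag_mx d *m U.
  by apply: IHn; rewrite trmx_drsub M1sym.
pose V : 'M[R]_(1 + n) := block_mx 1%:M 0 0 U.
have VV : V *m V^T = 1%:M.
  rewrite /V tr_block_mx mulmx_block !trmx0 !mulmx0 !mul0mx !addr0 !add0r.
  by rewrite trmx1 mulmx1 UU -scalar_mx_block.
pose d1 : 'rV[R]_(1 + n) := row_mx (ulsubmx M1) d.
exists (V *m H), d1; split.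
  by rewrite trmx_mul mulmxA -(mulmxA V) HH mulmx1 VV.
have M1E : M1 = V^T *m diag_mx d1 *m V.
  rewrite -[LHS]submxK M1ur M1dl M'E /d1 diag_mx_row /V tr_block_mx.
  rewrite !mulmx_block !trmx0 !mulmx0 !mul0mx !addr0 !add0r trmx1 mulmx1 mul1mx.
  congr block_mx; rewrite ?mul0mx //; apply/matrixP => i j.
  by rewrite [RHS]mxE !ord1 eqxx.
rewrite trmx_mul; have -> : M = H^T *m M1 *m H.
  by rewrite /M1 !mulmxA HTH mul1mx -mulmxA HTH mulmx1.
by rewrite M1E !mulmxA.
Qed.

End SpectralTheorem.

(** * Sums over the spectrum *)

Section SpectralSums.
Variable R : rcfType.

(** The rows of [U] are orthonormal eigenvectors, so [v *m U^T] is the vector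
    [v] in eigencoordinates. *)
Definition diagonalizes n (U : 'M[R]_n) (d : 'rV[R]_n) (M : 'M[R]_n) :=
  U *m U^T = 1%:M /\ M = U^T *m diag_mx d *m U.

Definition spectral_sum (f : R -> R) n (M : 'M[R]_n) : R :=
  \sum_(i < n) f (lambda M i).

Lemma spectral_sum_roots f n (M : 'M[R]_n) (s : seq R) :
  char_poly M = \prod_(x <- s) ('X - x%:P) ->
  spectral_sum f M = \sum_(x <- s) f x.
Proof.
move=> Ms; have ps := spectrum_perm Ms; rewrite -(perm_big _ ps) /=.
have sn : size (spectrum M) = n.
  apply/succn_inj.
  by rewrite (perm_size ps) -(size_char_poly M) Ms size_prod_XsubC.
by rewrite (big_nth 0) big_mkord sn.
Qed.

Lemma char_poly_orthogonal n (U D : 'M[R]_n) : U *m U^T = 1%:M ->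
  char_poly (U^T *m D *m U) = char_poly D.
Proof.
move=> UU; have UTU := mulmx1C UU.
have UPU : map_mx polyC U^T *m map_mx polyC U = 1%:M.
  by rewrite -map_mxM UTU map_mx1.
rewrite /char_poly /char_poly_mx !map_mxM.
have {1}-> : 'X%:M = map_mx polyC U^T *m 'X%:M *m map_mx polyC U.
  by rewrite scalar_mxC -mulmxA UPU mulmx1.
by rewrite -mulmxBl -mulmxBr !det_mulmx mulrAC -det_mulmx UPU det1 mul1r.
Qed.

Lemma char_poly_diag n (d : 'rV[R]_n) :
  char_poly (diag_mx d) = \prod_i ('X - (d 0 i)%:P).
Proof.
rewrite char_poly_trig ?diag_mx_is_trig //.
by apply: eq_bigr => i _; rewrite mxE eqxx mulr1n.
Qed.

Lemma spectral_sum_orthogonal f n (U D : 'M[R]_n) : D^T = D ->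
  U *m U^T = 1%:M -> spectral_sum f (U^T *m D *m U) = spectral_sum f D.
Proof.
move=> /char_poly_split[s _ Ds] UU; rewrite (spectral_sum_roots _ Ds).
by apply: spectral_sum_roots; rewrite char_poly_orthogonal.
Qed.

Lemma spectral_sum_diag f n (d : 'rV[R]_n) :
  spectral_sum f (diag_mx d) = \sum_i f (d 0 i).
Proof.
rewrite (@spectral_sum_roots f _ _ [seq d 0 i | i <- enum 'I_n]).
  by rewrite big_map big_enum.
by rewrite char_poly_diag big_map big_enum.
Qed.

Lemma spectral_sum_diagonalizes f n (U : 'M[R]_n) d M : diagonalizes U d M ->
  spectral_sum f M = \sum_i f (d 0 i).
Proof.
move=> [UU ->].
by rewrite spectral_sum_orthogonal ?tr_diag_mx // spectral_sum_diag.
Qed.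

(** The order of the eigenvalues matters later, where partial sums of the
    spectral measure are compared. *)
Lemma diagonalizable_lambda n (M : 'M[R]_n) : M^T = M ->
  exists U, diagonalizes U (\row_i lambda M i) M.
Proof.
move=> Msym; have [U [d [UU ME]]] := symmetric_orthogonal_diagonalization Msym.
have szM : size (spectrum M) == n by have [->] := spectrum_symmetric Msym.
have : perm_eq (Tuple szM) [tuple d 0 i | i < n].
  apply: spectrum_perm; rewrite {1}ME char_poly_orthogonal // char_poly_diag.
  by rewrite big_map big_enum.
move=> /tuple_permP[s sE].
have dE i : lambda M i = d 0 (s i).
  rewrite /lambda; move: sE => /= ->.
  by rewrite (nth_map i) ?size_enum_ord // nth_ord_enum tnth_mktuple.
exists (row_perm s U); split.
  rewrite row_permE trmx_mul mulmxA -(mulmxA _ U) UU mulmx1.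
  by rewrite tr_perm_mx -perm_mxM mulgV perm_mx1.
have -> : \row_i lambda M i = col_perm s d.
  by apply/rowP => i; rewrite !mxE dE.
rewrite {1}ME; apply/matrixP => i j; rewrite !mxE.
rewrite [RHS](reindex_inj (@perm_inj _ s^-1)) /=; apply: eq_bigr => k _.
rewrite !mxE permKV; congr (_ * _).
rewrite [RHS](reindex_inj (@perm_inj _ s^-1)) /=; apply: eq_bigr => l _.
by rewrite !mxE !permKV (inj_eq perm_inj).
Qed.

Lemma lambda_anti n (M : 'M[R]_n) (i j : 'I_n) : M^T = M ->
  (i <= j)%N -> lambda M j <= lambda M i.
Proof.
move=> Msym ij; have [szM _] := spectrum_symmetric Msym.
apply: (sorted_leq_nth (leT := >=%O)) (spectrum_sorted M) _ _ _ _ ij.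
- by move=> y x z /= yx zy; apply: le_trans zy yx.
- by move=> x /=.
- by rewrite inE szM.
- by rewrite inE szM.
Qed.

(** Convexity on the whole line, in the form that makes Jensen's inequality
    immediate. *)
Definition has_support_lines (g : R -> R) :=
  forall x, exists c, forall y, g x + c * (y - x) <= g y.

(** Average the support line of [g] at the mean. *)
Lemma jensen (g : R -> R) (I : finType) (w x : I -> R) : has_support_lines g ->
  (forall i, 0 <= w i) -> \sum_i w i = 1 ->
  g (\sum_i w i * x i) <= \sum_i w i * g (x i).
Proof.
move=> gP w0 w1; set m := \sum_i w i * x i; have [c cP] := gP m.
have -> : g m = \sum_i w i * (g m + c * (x i - m)).
  under eq_bigr => i _ do rewrite mulrDr mulrCA mulrBr.
  rewrite big_split /= -mulr_suml w1 mul1r -mulr_sumr sumrB -mulr_suml w1.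
  by rewrite mul1r subrr mulr0 addr0.
by apply: ler_sum => i _; rewrite ler_wpM2l.
Qed.

Lemma orthogonal_row_norm n (U : 'M[R]_n) i : U *m U^T = 1%:M ->
  \sum_j U i j ^+ 2 = 1.
Proof.
move=> /matrixP/(_ i i) UU; transitivity ((U *m U^T) i i).
  by rewrite mxE; apply: eq_bigr => j _; rewrite mxE expr2.
by rewrite UU mxE eqxx.
Qed.

Lemma conj_diag_entry n (W : 'M[R]_n) (d : 'rV[R]_n) i :
  (W *m diag_mx d *m W^T) i i = \sum_j W i j ^+ 2 * d 0 j.
Proof.
rewrite mxE; apply: eq_bigr => j _.
by rewrite mul_mx_diag !mxE expr2 mulrAC.
Qed.

(** Peierls' inequality: in any orthonormal basis the diagonal of a symmetric
    matrix is an average of its eigenvalues with doubly stochastic weights. *)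
Lemma peierls (f : R -> R) n (B U : 'M[R]_n) : has_support_lines f ->
  B^T = B -> U *m U^T = 1%:M ->
  \sum_i f ((U *m B *m U^T) i i) <= spectral_sum f B.
Proof.
move=> fP Bsym UU; have [V [VV BE]] := diagonalizable_lambda Bsym.
set d := \row_i _ in BE; pose W := U *m V^T.
have WW : W *m W^T = 1%:M.
  by rewrite /W trmx_mul trmxK mulmxA -(mulmxA U) (mulmx1C VV) mulmx1.
have UBU : U *m B *m U^T = W *m diag_mx d *m W^T.
  by rewrite /W trmx_mul trmxK {1}BE !mulmxA.
have WTW : W^T *m W^T^T = 1%:M by rewrite trmxK; apply: mulmx1C.
have -> : spectral_sum f B = \sum_i \sum_j W i j ^+ 2 * f (d 0 j).
  rewrite exchange_big; apply: eq_bigr => j _ /=.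
  rewrite -mulr_suml mxE -[LHS]mul1r; congr (_ * _).
  rewrite -(orthogonal_row_norm j WTW).
  by apply: eq_bigr => i _; rewrite mxE.
apply: ler_sum => i _; rewrite UBU conj_diag_entry.
apply: jensen => // [j|]; first exact: sqr_ge0.
exact: orthogonal_row_norm WW.
Qed.

End SpectralSums.

(** * Perturbing a matrix by a diagonal or by a rank-one matrix *)

Section TraceInequalities.
Variables (R : realType) (f f' : R -> R).
Hypothesis f_tangent : forall x y, f x + f' x * (y - x) <= f y.
Hypothesis f'_ge0 : forall x, 0 <= f' x.
Hypothesis f'_convex : has_support_lines f'.

Lemma tangent_support_lines : has_support_lines f.
Proof. by move=> x; exists (f' x) => y. Qed.

Lemma slope_homo x y : x <= y -> f' x <= f' y.
Proof.
rewrite le_eqVlt => /predU1P[->//|xy].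
have xy0 : 0 < y - x by rewrite subr_gt0.
rewrite -(ler_pM2r xy0).
by have := f_tangent x y; have := f_tangent y x; lra.
Qed.

Lemma tangent_homo x y : x <= y -> f x <= f y.
Proof.
move=> xy; apply: le_trans (f_tangent x y).
by rewrite lerDl mulr_ge0 // subr_ge0.
Qed.

(** Of the four points involved, [s] and [s' + b] are the inner ones; the
    tangents at these two give the bound, whichever of them is smaller. *)
Lemma increment_homo s s' b : s' <= s -> 0 <= b ->
  f s - f s' <= f (s + b) - f (s' + b).
Proof.
move=> ss b0; have [h|h] := leP s (s' + b).
  have := slope_homo h; rewrite -subr_ge0 => h'.
  have ss0 : 0 <= s - s' by rewrite subr_ge0.
  have := mulr_ge0 h' ss0.
  by have := f_tangent s s'; have := f_tangent (s' + b) (s + b); lra.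
have := slope_homo (ltW h); rewrite -subr_ge0 => h'.
have := mulr_ge0 h' b0.
by have := f_tangent s (s + b); have := f_tangent (s' + b) s'; lra.
Qed.

(** In the eigenbasis of [M] the diagonal can only increase. *)
Lemma spectral_sum_add_rank_one n (M : 'M[R]_n) (w : 'rV[R]_n) : M^T = M ->
  spectral_sum f M <= spectral_sum f (M + w^T *m w).
Proof.
move=> Msym; have [U UM] := diagonalizable_lambda Msym.
have [UU ME] := UM; set d := \row_i _ in UM ME.
have Bsym : (M + w^T *m w)^T = M + w^T *m w.
  by rewrite linearD /= Msym trmx_mul trmxK.
apply: le_trans (peierls tangent_support_lines Bsym UU).
rewrite (spectral_sum_diagonalizes _ UM); apply: ler_sum => i _.
apply: tangent_homo; rewrite mulmxDr mulmxDl ME !mulmxA UU mul1mx.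
rewrite -!(mulmxA (diag_mx d)) UU mulmx1 [leRHS]mxE.
rewrite [diag_mx d i i]mxE eqxx mulr1n.
rewrite lerDl -mulmxA mxE big_ord1.
have -> : U *m w^T = (w *m U^T)^T by rewrite trmx_mul trmxK.
by rewrite mxE -expr2 sqr_ge0.
Qed.

(** Adding a small nonnegative diagonal: the first-order term is a trace
    against [f'(N)], whose diagonal entries Jensen bounds below by [f'] of
    those of [N]. *)
Lemma spectral_sum_add_diag_step n (N : 'M[R]_n) (p : 'rV[R]_n) : N^T = N ->
  (forall k, 0 <= p 0 k) ->
  spectral_sum f N + \sum_k p 0 k * f' (N k k)
    <= spectral_sum f (N + diag_mx p).
Proof.
move=> Nsym p0; have [U UN] := diagonalizable_lambda Nsym.
have [UU NE] := UN; set d := \row_i _ in UN NE.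
have Bsym : (N + diag_mx p)^T = N + diag_mx p.
  by rewrite linearD /= Nsym tr_diag_mx.
apply: le_trans (peierls tangent_support_lines Bsym UU).
rewrite (spectral_sum_diagonalizes _ UN).
have BE i : (U *m (N + diag_mx p) *m U^T) i i =
            d 0 i + \sum_k U i k ^+ 2 * p 0 k.
  rewrite -conj_diag_entry mulmxDr mulmxDl mxE; congr (_ + _).
  by rewrite NE !mulmxA UU mul1mx -mulmxA UU mulmx1 [LHS]mxE eqxx mulr1n.
have -> : \sum_i f ((U *m (N + diag_mx p) *m U^T) i i) =
          \sum_i f (d 0 i + \sum_k U i k ^+ 2 * p 0 k).
  by apply: eq_bigr => i _; rewrite BE.
apply: le_trans (_ : \sum_i (f (d 0 i) +
         f' (d 0 i) * \sum_k U i k ^+ 2 * p 0 k) <= _); last first.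
  apply: ler_sum => i _; apply: le_trans (f_tangent (d 0 i) _).
  by rewrite [d 0 i + _]addrC addrK.
rewrite big_split lerD2l /=.
under [leRHS]eq_bigr => i _ do rewrite mulr_sumr.
rewrite exchange_big; apply: ler_sum => k _ /=.
have -> : N k k = \sum_i U i k ^+ 2 * d 0 i.
  rewrite NE -[X in _ *m X]trmxK conj_diag_entry.
  by apply: eq_bigr => i _; rewrite mxE.
apply: le_trans (_ : p 0 k * \sum_i U i k ^+ 2 * f' (d 0 i) <= _).
  rewrite ler_wpM2l // jensen // => [i|]; first exact: sqr_ge0.
  have UTU : U^T *m U^T^T = 1%:M by rewrite trmxK; apply: mulmx1C.
  rewrite -(orthogonal_row_norm k UTU).
  by apply: eq_bigr => i _; rewrite mxE.
by rewrite mulr_sumr ler_sum // => i _; rewrite mulrC -mulrA mulrCA lexx.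
Qed.

(** The subtracted term pays for replacing each increment of [f] by the slope
    at the left end of a step; it telescopes over the steps. *)
Lemma spectral_sum_add_diag_steps n (N : 'M[R]_n) (q : 'rV[R]_n) m :
    N^T = N -> (forall k, 0 <= q 0 k) ->
  spectral_sum f N + \sum_k (f (N k k + q 0 k *+ m) - f (N k k)
      - q 0 k * (f' (N k k + q 0 k *+ m) - f' (N k k)))
    <= spectral_sum f (N + diag_mx (q *+ m)).
Proof.
move=> Nsym q0; elim: m => [|m IHm].
  rewrite mulr0n linear0 addr0 big1 ?addr0 // => k _.
  by rewrite mulr0n addr0 !subrr mulr0 subr0.
rewrite mulrSr linearD /= addrA.
have Nmsym : (N + diag_mx (q *+ m))^T = N + diag_mx (q *+ m).
  by rewrite linearD /= Nsym tr_diag_mx.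
apply: le_trans (spectral_sum_add_diag_step Nmsym q0).
apply: le_trans (lerD IHm (lexx _)); rewrite -addrA lerD2l -big_split /=.
apply: ler_sum => k _; rewrite 2!mxE eqxx mulr1n mulmxnE mulrSr.
set z := N k k + _ *+ _; rewrite addrA -/z.
by have := f_tangent (z + q 0 k) z; lra.
Qed.

(** A nonnegative diagonal matrix is added in [m] equal steps, whose errors add
    up to [E / m] with [E] independent of [m]; then [m] tends to infinity. *)
Lemma spectral_sum_add_diag n (N : 'M[R]_n) (p : 'rV[R]_n) : N^T = N ->
  (forall k, 0 <= p 0 k) ->
  spectral_sum f N + \sum_k (f (N k k + p 0 k) - f (N k k))
    <= spectral_sum f (N + diag_mx p).
Proof.
move=> Nsym p0; set A := _ + _; set B := spectral_sum f (N + _).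
pose E := \sum_k p 0 k * (f' (N k k + p 0 k) - f' (N k k)).
have E0 : 0 <= E.
  apply: sumr_ge0 => k _; rewrite mulr_ge0 // subr_ge0 slope_homo //.
  by rewrite lerDl.
have AB m : A - E / m.+1%:R <= B.
  pose q := m.+1%:R^-1 *: p.
  have q0 k : 0 <= q 0 k by rewrite mxE mulr_ge0 // invr_ge0 ler0n.
  have qp : q *+ m.+1 = p.
    by rewrite /q -scaler_nat scalerA mulfV ?scale1r // pnatr_eq0.
  have qkp k : q 0 k *+ m.+1 = p 0 k by rewrite -mulmxnE qp.
  have := spectral_sum_add_diag_steps m.+1 Nsym q0; rewrite qp -/B.
  apply: le_trans; rewrite /A -addrA lerD2l /E mulr_suml -sumrB.
  by apply: ler_sum => k _; rewrite qkp mxE mulrAC [_ / _]mulrC.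
rewrite leNgt; apply/negP => BA.
have AB0 : 0 < A - B by rewrite subr_gt0.
have := archi_boundP (divr_ge0 E0 (ltW AB0)); set m := Num.bound _ => Em.
have := AB m; rewrite lerBlDr -lerBlDl ler_pdivlMr ?ltr0Sn // => h.
move: Em; rewrite ltr_pdivrMr // => Em.
have : (A - B) * m.+1%:R < m%:R * (A - B) by apply: le_lt_trans Em.
by rewrite mulrC ltr_pM2r // ltr_nat ltnNge leqnSn.
Qed.

(** Rank-one perturbations have a larger effect on larger diagonal matrices:
    the diagonal entry [s 0 k] is moved up by [b 0 k ^+ 2], and a convex [f]
    has larger increments there. *)
Lemma spectral_sum_shift_rank_one n (s s' b : 'rV[R]_n) :
  (forall k, s' 0 k <= s 0 k) ->
  spectral_sum f (diag_mx s' + b^T *m b) + \sum_k f (s 0 k)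
    <= spectral_sum f (diag_mx s + b^T *m b) + \sum_k f (s' 0 k).
Proof.
move=> ss; have Nsym : (diag_mx s' + b^T *m b)^T = diag_mx s' + b^T *m b.
  by rewrite linearD /= tr_diag_mx trmx_mul trmxK.
have p0 k : 0 <= (s - s') 0 k by rewrite !mxE subr_ge0.
have := spectral_sum_add_diag Nsym p0.
have -> : diag_mx s' + b^T *m b + diag_mx (s - s') = diag_mx s + b^T *m b.
  by rewrite linearB /= addrC addrA subrK.
move=> h; rewrite -lerBlDr -addrA -sumrB; apply: le_trans h; rewrite lerD2l.
apply: ler_sum => k _.
have -> : (diag_mx s' + b^T *m b) k k = s' 0 k + b 0 k ^+ 2.
  by rewrite !mxE eqxx mulr1n big_ord1 !mxE expr2.
have -> : s' 0 k + b 0 k ^+ 2 + (s - s') 0 k = s 0 k + b 0 k ^+ 2.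
  by rewrite !mxE; ring.
by apply: increment_homo => //; apply: sqr_ge0.
Qed.

End TraceInequalities.

(** * The spectral shift of a rank-one perturbation *)

Section RankOneCharacteristicPolynomial.

(** The bordered matrix with blocks [1], [b], [b^T] and the diagonal of [c] has
    two block triangular factorizations, one for each Schur complement. *)
Lemma det_diag_sub_rank_one (F : fieldType) n (c b : 'rV[F]_n) :
  (forall k, c 0 k != 0) ->
  \det (diag_mx c - b^T *m b)
    = \prod_k c 0 k * (1 - \sum_k b 0 k ^+ 2 / c 0 k).
Proof.
move=> c0; pose ci : 'rV[F]_n := \row_k (c 0 k)^-1.
have cici : diag_mx ci *m diag_mx c = 1%:M.
  rewrite mulmx_diag -diag_const_mx; congr diag_mx.
  by apply/rowP => k; rewrite !mxE mulVf.
pose B : 'M[F]_(1 + n) := block_mx 1%:M b b^T (diag_mx c).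
have B1 : B = block_mx 1%:M 0 b^T 1%:M *m
              block_mx 1%:M b 0 (diag_mx c - b^T *m b).
  rewrite mulmx_block ?mul1mx ?mulmx1 ?mul0mx ?mulmx0 ?addr0.
  by rewrite [b^T *m b + _]addrC subrK.
have B2 : B = block_mx 1%:M (b *m diag_mx ci) 0 1%:M *m
              block_mx (1%:M - b *m diag_mx ci *m b^T) 0 b^T (diag_mx c).
  rewrite mulmx_block ?mul1mx ?mul0mx ?mulmx0 ?add0r ?addr0 subrK.
  by rewrite -(mulmxA b) cici mulmx1.
transitivity (\det B).
  by rewrite B1 det_mulmx det_lblock det_ublock !det1 !mul1r.
rewrite B2 det_mulmx det_lblock det_ublock !det1 !mul1r det_diag mulrC.
congr (_ * _); rewrite [X in \det X]mx11_scalar det_scalar1 !mxE eqxx.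
congr (_ - _); apply: eq_bigr => k _.
by rewrite mul_mx_diag !mxE expr2 mulrAC.
Qed.

Variable R : rcfType.
Local Notation "p %:F" := (tofrac p).

(** The Stieltjes transform of the measure with mass [w 0 k] at [d 0 k], as a
    rational function. *)
Definition stieltjes n (d w : 'rV[R]_n) : {fraction {poly R}} :=
  \sum_k (w 0 k)%:P%:F / ('X - (d 0 k)%:P)%:F.

Lemma tofrac_XsubC_neq0 (x : R) : ('X - x%:P)%:F != 0.
Proof. by rewrite tofrac_eq0 polyXsubC_eq0. Qed.

Lemma char_poly_diag_add_rank_one n (s b : 'rV[R]_n) :
  (char_poly (diag_mx s + b^T *m b))%:F
    = (\prod_k ('X - (s 0 k)%:P))%:F * (1 - stieltjes s (\row_k b 0 k ^+ 2)).
Proof.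
pose c : 'rV[{fraction {poly R}}]_n := \row_k ('X - (s 0 k)%:P)%:F.
pose bF : 'rV[{fraction {poly R}}]_n := \row_k (b 0 k)%:P%:F.
have cE : map_mx (@tofrac _) (char_poly_mx (diag_mx s + b^T *m b)) =
          diag_mx c - bF^T *m bF.
  apply/matrixP => i j; rewrite !mxE !big_ord1 !mxE.
  rewrite polyCD polyCM opprD addrA tofracB tofracM; congr (_ - _).
  by case: eqP => [->|_]; rewrite ?mulr1n // !mulr0n subrr tofrac0.
rewrite /char_poly -det_map_mx cE det_diag_sub_rank_one => [|k]; last first.
  by rewrite mxE tofrac_XsubC_neq0.
rewrite rmorph_prod /=; congr (_ * (1 - _)).
  by apply: eq_bigr => k _; rewrite mxE.
by apply: eq_bigr => k _; rewrite !mxE polyC_exp tofracXn.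
Qed.

Lemma prod_XsubC_perm (s t : seq R) :
  \prod_(x <- s) ('X - x%:P) = \prod_(x <- t) ('X - x%:P) -> perm_eq s t.
Proof. by move=> st; apply/allP => x _ /=; rewrite -!mup_prod_XsubC st. Qed.

(** The ratio of the characteristic polynomials after and before a rank-one
    perturbation depends only on the spectral measure of the perturbing vector.
    The two dimensions may differ, so the atoms of the measure can be split. *)
Lemma spectral_shift_stieltjes f n m (s b : 'rV[R]_n) (d c : 'rV[R]_m) :
  stieltjes s (\row_k b 0 k ^+ 2) = stieltjes d (\row_k c 0 k ^+ 2) ->
  spectral_sum f (diag_mx s + b^T *m b) + \sum_k f (d 0 k)
    = spectral_sum f (diag_mx d + c^T *m c) + \sum_k f (s 0 k).
Proof.
move=> sd.
have sym n' (x y : 'rV[R]_n') : (diag_mx x + y^T *m y)^T = diag_mx x + y^T *m y.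
  by rewrite linearD /= tr_diag_mx trmx_mul trmxK.
have [sA _ As] := char_poly_split (sym _ s b).
have [sB _ Bs] := char_poly_split (sym _ d c).
rewrite (spectral_sum_roots _ As) (spectral_sum_roots _ Bs).
pose ss := [seq s 0 k | k <- enum 'I_n]; pose ds := [seq d 0 k | k <- enum 'I_m].
have -> : \sum_k f (s 0 k) = \sum_(x <- ss) f x by rewrite big_map big_enum.
have -> : \sum_k f (d 0 k) = \sum_(x <- ds) f x by rewrite big_map big_enum.
rewrite -!big_cat /=; apply: perm_big; apply: prod_XsubC_perm.
rewrite !big_cat -As -Bs !big_map -!enumT !big_enum /=.
apply/eqP; rewrite -tofrac_eq !tofracM !char_poly_diag_add_rank_one sd.
by apply/eqP; rewrite [LHS]mulrC -[RHS]mulrA [X in _ * X]mulrC.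
Qed.

End RankOneCharacteristicPolynomial.

(** * Monotonicity in the spectral measure *)

Section Coupling.
Variable R : realFieldType.

Definition clamp (a b x : R) : R := Num.max a (Num.min x b).

Lemma clamp_homo a b x y : x <= y -> clamp a b x <= clamp a b y.
Proof.
move=> xy; rewrite /clamp ge_max le_max lexx /= le_max; apply/orP; right.
by rewrite le_min ge_min xy ge_min lexx orbT.
Qed.

(** Both sides are the length of the overlap of [[a, b]] and [[c, d]]. *)
Lemma clamp_overlapC a b c d : a <= b -> c <= d ->
  clamp a b d - clamp a b c = clamp c d b - clamp c d a.
Proof.
move=> ab cd; rewrite /clamp.
by case: (leP d b) => ?; case: (leP c b) => ?; case: (leP a d) => ?;
   case: (leP a c) => ?; case: (leP a b) => ?; case: (leP c d) => ?; lra.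
Qed.

Variables (n : nat) (m m' : 'I_n -> R).
Hypotheses (m_ge0 : forall i, 0 <= m i) (m'_ge0 : forall i, 0 <= m' i).
Hypothesis m_total : \sum_i m i = \sum_i m' i.

Definition cumul (q : 'I_n -> R) (k : nat) : R := \sum_(l < n | (l < k)%N) q l.

Lemma cumulS q (i : 'I_n) : cumul q i.+1 = cumul q i + q i.
Proof.
rewrite /cumul (bigD1 i) //= addrC; congr (_ + _).
by apply: eq_bigl => l; rewrite ltnS -(inj_eq val_inj) /= andbC -ltn_neqAle.
Qed.

Lemma cumul0 q : cumul q 0 = 0.
Proof. by rewrite /cumul big_pred0. Qed.

Lemma cumuln q : cumul q n = \sum_i q i.
Proof. by apply: eq_bigl => i; rewrite ltn_ord. Qed.

Lemma cumul_homo q j k : (forall i, 0 <= q i) -> (j <= k)%N ->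
  cumul q j <= cumul q k.
Proof.
move=> q0 jk; rewrite /cumul big_mkcond [leRHS]big_mkcond.
apply: ler_sum => i _; case: ltnP => ij; case: ltnP => ik //.
by have := leq_trans ij jk; rewrite ltnNge ik.
Qed.

Lemma sum_clamp_cumul q a b : a <= b -> 0 <= a -> b <= \sum_i q i ->
  \sum_(j < n) (clamp a b (cumul q j.+1) - clamp a b (cumul q j)) = b - a.
Proof.
move=> ab a0 bq.
have := telescope_sumr (fun k => clamp a b (cumul q k)) (leq0n n).
rewrite big_mkord => ->; rewrite cumuln cumul0 /clamp.
by rewrite (min_idPr bq) (max_idPr ab) min_l ?(le_trans a0) // (max_idPl a0).
Qed.

(** Lay out both families as consecutive intervals of the same segment; the mass
    sent from [i] to [j] is the length of the overlap of the [i]-th interval of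
    [m'] with the [j]-th interval of [m]. *)
Lemma quantile_coupling : exists pi : 'I_n -> 'I_n -> R,
  [/\ forall i j, 0 <= pi i j,
      forall i, \sum_j pi i j = m' i,
      forall j, \sum_i pi i j = m j
    & forall i j, pi i j != 0 -> cumul m j < cumul m' i.+1].
Proof.
pose ov i j := clamp (cumul m' i) (cumul m' i.+1) (cumul m j.+1)
             - clamp (cumul m' i) (cumul m' i.+1) (cumul m j).
have cumul_ge0 q k : (forall i, 0 <= q i) -> 0 <= cumul q k.
  by move=> q0; apply: sumr_ge0.
have cumul_le q k : (forall i, 0 <= q i) -> cumul q k <= \sum_i q i.
  move=> q0; rewrite /cumul big_mkcond /=; apply: ler_sum => i _.
  by case: ifP.
exists (fun i j : 'I_n => ov i j); split=> [i j|i|j|i j].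
- by rewrite subr_ge0 clamp_homo // cumul_homo.
- rewrite sum_clamp_cumul ?cumul_homo ?cumul_ge0 ?m_total ?cumul_le //.
  by rewrite cumulS addrC addKr.
- under eq_bigr => i _ do rewrite /ov clamp_overlapC ?cumul_homo //.
  rewrite sum_clamp_cumul ?cumul_homo ?cumul_ge0 -?m_total ?cumul_le //.
  by rewrite cumulS addrC addKr.
apply: contra_neqT; rewrite -leNgt => h; rewrite /ov /clamp.
have hm : cumul m j <= cumul m j.+1 by exact: cumul_homo.
by rewrite (min_idPr (le_trans h hm)) (min_idPr h) subrr.
Qed.

End Coupling.

Section Dominance.
Variables (R : realType) (f f' : R -> R).
Hypothesis f_tangent : forall x y, f x + f' x * (y - x) <= f y.
Hypothesis f'_convex : has_support_lines f'.

Lemma sum_mxvec (V : nmodType) n (G : 'I_(n * n) -> V) :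
  \sum_k G k = \sum_i \sum_j G (mxvec_index i j).
Proof.
rewrite (reindex _ (curry_mxvec_bij _ _)) /= pair_bigA /=.
by apply: eq_bigr => -[i j].
Qed.

(** A coupling of the spectral measures of [w] and [u] that moves mass only
    upwards gives one vector [b], indexed by pairs of eigenvalues, which
    perturbs a diagonal matrix [s'] as [w] perturbs [M], and a larger diagonal
    matrix [s] as [u] does. *)
Lemma spectral_sum_dominance n (M U : 'M[R]_n) (u w : 'rV[R]_n) : M^T = M ->
    diagonalizes U (\row_i lambda M i) M ->
    \sum_l (w *m U^T) 0 l ^+ 2 = \sum_l (u *m U^T) 0 l ^+ 2 ->
    (forall t, \sum_(l | t <= lambda M l) (w *m U^T) 0 l ^+ 2
                 <= \sum_(l | t <= lambda M l) (u *m U^T) 0 l ^+ 2) ->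
  spectral_sum f (M + w^T *m w) <= spectral_sum f (M + u^T *m u).
Proof.
move=> Msym [UU ME] uw_total uw_tail; set d := \row_i _ in ME.
have redE (v : 'rV[R]_n) : spectral_sum f (M + v^T *m v) =
    spectral_sum f (diag_mx d + (v *m U^T)^T *m (v *m U^T)).
  rewrite -[RHS](@spectral_sum_orthogonal _ f _ U) //; last first.
    by rewrite linearD /= tr_diag_mx trmx_mul trmxK.
  congr (spectral_sum f _); rewrite mulmxDr mulmxDl -ME trmx_mul trmxK.
  by rewrite !mulmxA (mulmx1C UU) mul1mx -mulmxA (mulmx1C UU) mulmx1.
rewrite !redE; set uh := u *m _ in uw_total uw_tail *.
set wh := w *m _ in uw_total uw_tail *.
have [pi [pi0 pi_w pi_u pi_ij]] := quantile_coupling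
  (fun l => sqr_ge0 (uh 0 l)) (fun l => sqr_ge0 (wh 0 l)) (esym uw_total).
(* Mass sent from [i] to an eigenvalue below that of [i] would contradict the
   domination of the tails at the threshold [lambda M i]. *)
have pi_le i j : pi i j != 0 -> d 0 i <= d 0 j.
  move=> /pi_ij; rewrite leNgt; apply: contraTN; rewrite !mxE => dji.
  rewrite -leNgt; apply: le_trans (_ : \sum_(l | lambda M i <= lambda M l)
    wh 0 l ^+ 2 <= _).
    rewrite /cumul big_mkcond [leRHS]big_mkcond /=; apply: ler_sum => l _.
    case: ltnP => li; last by case: ifP; rewrite ?sqr_ge0.
    by rewrite (lambda_anti Msym (li : (l <= i)%N)).
  apply: le_trans (uw_tail _) _.
  rewrite /cumul big_mkcond [leRHS]big_mkcond /=; apply: ler_sum => l _.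
  case: ifP => il; case: ltnP => // jl; last by rewrite sqr_ge0.
  by have := lambda_anti Msym jl; rewrite leNgt (lt_le_trans dji il).
pose b := mxvec (\matrix_(i, j) Num.sqrt (pi i j)).
pose s' := mxvec (\matrix_(i < n, j < n) d 0 i).
(* The maximum is [d 0 j] wherever [pi] is positive, and keeps [s' <= s] at
   the other pairs. *)
pose s := mxvec (\matrix_(i, j) Num.max (d 0 i) (d 0 j)).
have ss k : s' 0 k <= s 0 k.
  by case/mxvec_indexP: k => i j; rewrite !mxvecE !mxE le_max lexx.
have su : stieltjes s (\row_k b 0 k ^+ 2) = stieltjes d (\row_k uh 0 k ^+ 2).
  rewrite /stieltjes sum_mxvec exchange_big; apply: eq_bigr => j _ /=.
  rewrite mxE -pi_u !raddf_sum /= mulr_suml; apply: eq_bigr => i _.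
  rewrite mxE !mxvecE !mxE sqr_sqrtr //.
  have [->|/pi_le] := eqVneq (pi i j) 0; first by rewrite !raddf0 !mul0r.
  by rewrite !mxE => /max_idPr ->.
have sw : stieltjes s' (\row_k b 0 k ^+ 2) = stieltjes d (\row_k wh 0 k ^+ 2).
  rewrite /stieltjes sum_mxvec; apply: eq_bigr => i _ /=.
  rewrite mxE -pi_w !raddf_sum /= mulr_suml; apply: eq_bigr => j _.
  by rewrite mxE !mxvecE !mxE sqr_sqrtr.
have := spectral_sum_shift_rank_one f_tangent f'_convex b ss.
by have := spectral_shift_stieltjes f su; have := spectral_shift_stieltjes f sw; lra.
Qed.

End Dominance.

(** * The two ends of a pendant path *)

Section PendantPath.
Variables (R : realType) (n : nat) (M U : 'M[R]_n) (d : 'rV[R]_n).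
Hypothesis U_M : diagonalizes U d M.
Hypothesis d_ge0 : forall l, 0 <= d 0 l.
Variables (sg : R) (m : nat) (e : nat -> 'rV[R]_n).
Hypothesis sg_sign : sg = 1 \/ sg = -1.
Hypothesis e_orthonormal : forall i j, (i <= m)%N -> (j <= m)%N ->
  e i *m (e j)^T = (i == j)%:R%:M.
Hypothesis e_end : (0 < m)%N -> e 0 *m M = e 0 + sg *: e 1.
Hypothesis e_inner : forall k, (k.+1 < m)%N ->
  e k.+1 *m M = sg *: e k + 2 *: e k.+1 + sg *: e k.+2.

(** In terms of the edges of the path, [M] maps the [k]-th alternating sum to
    the vector of the [k]-th edge, see alternating_sum_mul. *)
Fixpoint alternating_sum k :=
  if k is k'.+1 then e k - sg *: alternating_sum k' else e 0.
Local Notation s := alternating_sum.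

Lemma sg2 : sg * sg = 1.
Proof. by case: sg_sign => ->; rewrite ?mulrNN mulr1. Qed.

Lemma alternating_sum_mul k : (k < m)%N -> s k *m M = e k + sg *: e k.+1.
Proof.
elim: k => [|k IHk] km; first by rewrite /= e_end.
rewrite /= mulmxBl e_inner // -scalemxAl IHk ?(ltnW km) //.
rewrite scalerDr scalerA sg2 scale1r opprD addrACA addrAC addrA.
rewrite [X in X - sg *: e k]addrAC -!addrA [sg *: e k + _]addrC.
by rewrite !addrA scaler_nat mulr2n addrK; apply/rowP => l; rewrite !mxE; ring.
Qed.

Lemma dot_alternating_sum_gt k j : (j < k)%N -> (k <= m)%N ->
  e k *m (s j)^T = 0.
Proof.
elim: j => [|j IHj] jk km.
  by rewrite /= e_orthonormal // gtn_eqF // raddf0.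
rewrite /= linearB linearZ /= mulmxBr -scalemxAr IHj ?(ltnW jk) //.
rewrite e_orthonormal // ?(leq_trans (ltnW jk)) // gtn_eqF //.
by rewrite scaler0 subr0 raddf0.
Qed.

Lemma dot_alternating_sum_diag j : (j <= m)%N -> e j *m (s j)^T = 1%:M.
Proof.
case: j => [|j] jm; first by rewrite /= e_orthonormal.
rewrite /= linearB linearZ /= mulmxBr -scalemxAr dot_alternating_sum_gt //.
by rewrite e_orthonormal // eqxx scaler0 subr0.
Qed.

Lemma alternating_sum_orthogonal k j : (k < j)%N -> (j <= m)%N ->
  (e k + sg *: e k.+1) *m (s j)^T = 0.
Proof.
elim: j => [//|j IHj]; rewrite ltnS leq_eqVlt => /predU1P[->|kj] jm.
  rewrite mulmxDl -scalemxAl dot_alternating_sum_diag //= linearB linearZ /=.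
  rewrite mulmxBr -scalemxAr dot_alternating_sum_diag ?(ltnW jm) //.
  by rewrite e_orthonormal ?(ltnW jm) // ltn_eqF // raddf0 sub0r addNr.
rewrite /= linearB linearZ /= mulmxBr -scalemxAr IHj ?(ltnW jm) //.
have km := leq_trans kj (ltnW jm).
rewrite mulmxDl -scalemxAl !e_orthonormal ?(ltnW km) //.
rewrite !ltn_eqF ?ltnS ?(ltnW kj) //.
by rewrite raddf0 !scaler0 subr0 addr0.
Qed.

Local Notation f k l := ((e k *m U^T) 0 l).
Local Notation g k l := ((s k *m U^T) 0 l).

Lemma path_coordE k l : f k.+1 l = g k.+1 l + sg * g k l.
Proof. by rewrite /= mulmxBl -scalemxAl !mxE subrK. Qed.

Lemma path_coord_eigen k l : (k < m)%N -> d 0 l * g k l = f k l + sg * f k.+1 l.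
Proof.
move=> km; have [UU ME] := U_M.
have -> : f k l + sg * f k.+1 l = (s k *m M *m U^T) 0 l.
  by rewrite alternating_sum_mul // mulmxDl -scalemxAl !mxE.
rewrite ME !mulmxA -(mulmxA _ U) UU mulmx1.
by rewrite mul_mx_diag [RHS]mxE mulrC.
Qed.

Lemma path_coord_orthogonal k : (k < m)%N ->
  \sum_l d 0 l * g k l * g m l = 0.
Proof.
move=> km; have [UU _] := U_M.
under eq_bigr => l _ do rewrite path_coord_eigen //.
have := alternating_sum_orthogonal km (leqnn m).
rewrite -[X in X *m _]mulmx1 -(mulmx1C UU) mulmxA -mulmxA -[U *m _]trmxK.
rewrite trmx_mul trmxK => /matrixP/(_ 0 0); rewrite dotmxE [RHS]mxE => h.
rewrite -[RHS]h; apply: eq_bigr => l _; congr (_ * _).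
by rewrite mulmxDl -scalemxAl !mxE.
Qed.

(** The squares telescope along the path: [e (k + 1)] is
    [s (k + 1) + sg *: s k], and [e k + sg *: e (k + 1)] is [s k] times the
    eigenvalue. *)
Lemma path_coord_sqr k l : (k < m)%N ->
  f k.+1 l ^+ 2 - f 0 l ^+ 2 = sg * (d 0 l * g k.+1 l * g k l).
Proof.
elim: k => [|k IHk] km.
  have := path_coord_eigen l km; rewrite !path_coordE /= => h.
  rewrite mulrAC h.
  by case: sg_sign => ->; ring.
have h := path_coord_eigen l km.
have := IHk (ltnW km); rewrite h mulrAC h => h1.
have -> : f k.+2 l ^+ 2 - f 0 l ^+ 2 =
    f k.+2 l ^+ 2 - f k.+1 l ^+ 2 + (f k.+1 l ^+ 2 - f 0 l ^+ 2) by ring.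
by rewrite h1 !path_coordE; case: sg_sign => ->; ring.
Qed.

Lemma path_coord_rec0 l : (0 < m)%N -> sg * (d 0 l - 2) * g 0 l = g 1 l.
Proof.
move=> m0; have := path_coord_eigen l m0; rewrite path_coordE => h.
by rewrite -mulrA mulrBl h; case: sg_sign => ->; rewrite /=; ring.
Qed.

Lemma path_coord_rec k l : (k.+1 < m)%N ->
  sg * (d 0 l - 2) * g k.+1 l = g k.+2 l + g k l.
Proof.
move=> km; have := path_coord_eigen l km; rewrite !path_coordE => h.
by rewrite -mulrA mulrBl h; case: sg_sign => ->; ring.
Qed.

Lemma path_adjacency_sum (h : nat -> R) (j : 'I_m) :
  \sum_k adjacency_mx R (path_graph m) j k * h k
    = (if (j.+1 < m)%N then h j.+1 else 0) + (if (0 < j)%N then h j.-1 else 0).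
Proof.
have AE k : adjacency_mx R (path_graph m) j k * h k =
    (if k == j.+1 :> nat then h k else 0) + (if j == k.+1 :> nat then h k else 0).
  rewrite mxE /= /path_rel /=.
  have [kj|kj] := eqVneq (k : nat) j.+1.
    rewrite kj; have -> : (j == j.+2 :> nat) = false.
      by apply/negbTE; rewrite neq_ltn leqW.
    by rewrite mul1r addr0.
  by case: eqP => _; rewrite ?mul1r ?mul0r add0r.
under eq_bigr => k _ do rewrite AE.
rewrite big_split /= -!big_mkcond /=; congr (_ + _).
  case: ltnP => jm; first by rewrite (big_pred1 (Ordinal jm)).
  by rewrite big_pred0 // => k; rewrite ltn_eqF // (leq_trans (ltn_ord k)).
case: posnP => [j0|j_gt0].
  by rewrite big_pred0 // => k; rewrite j0.
have jm : (j.-1 < m)%N by apply: leq_ltn_trans (leq_pred j) (ltn_ord j).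
rewrite (big_pred1 (Ordinal jm)) // => k.
by rewrite -{1}(prednK j_gt0) eqSS eq_sym.
Qed.

(** The vectors [s k], read in one eigenvector of [M], almost form an
    eigenvector of the path on [m] vertices; the defect sits at its end. *)
Lemma path_coord_adjacency l (j : 'I_m) :
  sg * (d 0 l - 2) * g j l
    = \sum_k adjacency_mx R (path_graph m) j k * g k l
      + (j.+1 == m)%:R * g m l.
Proof.
rewrite (path_adjacency_sum (fun k => g k l)).
have := ltn_ord j; rewrite leq_eqVlt => /predU1P[jm|jm].
  rewrite jm ltnn eqxx mul1r add0r.
  case: j jm => -[|k] /= km mE; last by rewrite path_coord_rec // addrC mE.
  by rewrite path_coord_rec0 // add0r -mE.
rewrite jm ltn_eqF // mul0r addr0.
case: j jm => -[|k] /= _ km; first by rewrite path_coord_rec0 ?(ltnW km) ?addr0.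
by rewrite path_coord_rec ?(ltnW km).
Qed.

Lemma adjacency_sym k (G : graph k) : (adjacency_mx R G)^T = adjacency_mx R G.
Proof. by apply/matrixP => i j; rewrite !mxE adj_sym. Qed.

(** In an eigenbasis the squared coordinates of the two ends of the path differ
    by a combination, with nonnegative coefficients, of the functions
    [x * (x - mu)] of the eigenvalue [x]; for each [mu] the total is zero, and
    the summands are negative exactly for eigenvalues below [mu]. So every
    upper tail of the total is nonnegative. *)
Lemma end_tail_le t :
  \sum_(l | t <= d 0 l) f 0 l ^+ 2 <= \sum_(l | t <= d 0 l) f m l ^+ 2.
Proof.
have [->//|m_gt0] := posnP m.
have [V VA] := diagonalizable_lambda (adjacency_sym (path_graph m)).
have [VV AE] := VA; set A := adjacency_mx _ _ in VA AE.
set z := \row_i _ in VA AE; have VTV := mulmx1C VV.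
pose alpha i l := \sum_k V i k * g k l.
(* [alpha i l] is a coordinate of the vector of the [g k l] in the eigenbasis
   of the path, and [v i] is the last entry of the [i]-th eigenvector. *)
pose v i := \sum_k V i k * (k.+1 == m)%:R.
have VAE i k : \sum_j V i j * A j k = z 0 i * V i k.
  transitivity ((V *m A) i k); first by rewrite mxE.
  by rewrite AE !mulmxA VV mul1mx mul_diag_mx mxE.
have alphaE i l : (sg * (d 0 l - 2) - z 0 i) * alpha i l = v i * g m l.
  rewrite mulrBl [z 0 i * _]mulr_sumr.
  under [X in _ - X]eq_bigr => k _ do rewrite mulrA -VAE mulr_suml.
  rewrite exchange_big mulr_sumr -sumrB mulr_suml; apply: eq_bigr => j _ /=.
  rewrite mulrCA path_coord_adjacency mulrDr mulrA [X in X + _ - _]mulr_sumr.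
  under [X in _ - X]eq_bigr => k _ do rewrite -mulrA.
  by rewrite addrAC subrr add0r.
have v_alpha l : \sum_i v i * alpha i l = g m.-1 l.
  have m1m : (m.-1 < m)%N by rewrite prednK.
  have vE i : v i = V i (Ordinal m1m).
    rewrite /v (bigD1 (Ordinal m1m)) //= prednK // eqxx mulr1 big1 ?addr0 //.
    move=> k km; have /negbTE -> : k.+1 != m; last by rewrite mulr0.
    by apply: contra_neq km => km; apply/val_inj/succn_inj; rewrite /= km prednK.
  under eq_bigr => i _ do rewrite vE mulr_sumr.
  rewrite exchange_big (bigD1 (Ordinal m1m)) //= [X in _ + X]big1 ?addr0.
    under eq_bigr => i _ do rewrite mulrA -expr2.
    rewrite -mulr_suml -[RHS]mul1r; congr (_ * _).
    rewrite -(orthogonal_row_norm (U := V^T) (Ordinal m1m)) ?trmxK //.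
    by apply: eq_bigr => i _; rewrite mxE.
  move=> k km; under eq_bigr => i _ do rewrite mulrA.
  rewrite -mulr_suml; have /matrixP/(_ (Ordinal m1m) k) := VTV.
  rewrite mxE [RHS]mxE eq_sym (negbTE km).
  under eq_bigr => i _ do rewrite mxE.
  by move=> ->; rewrite mul0r.
pose mu i := 2 + sg * z 0 i.
have termE i l : sg * d 0 l * (v i * g m l) * alpha i l =
    d 0 l * (d 0 l - mu i) * alpha i l ^+ 2.
  have -> : d 0 l - mu i = sg * sg * (d 0 l - 2) - sg * z 0 i.
    by rewrite sg2 /mu; ring.
  by rewrite -alphaE; ring.
have sqrE l : f m l ^+ 2 - f 0 l ^+ 2 =
    \sum_i d 0 l * (d 0 l - mu i) * alpha i l ^+ 2.
  have m1m : (m.-1 < m)%N by rewrite prednK.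
  have := path_coord_sqr l m1m; rewrite (prednK m_gt0) -v_alpha => ->.
  by rewrite !mulr_sumr; apply: eq_bigr => i _; rewrite -termE; ring.
have total i : \sum_l d 0 l * (d 0 l - mu i) * alpha i l ^+ 2 = 0.
  transitivity (\sum_k sg * v i * V i k * \sum_l d 0 l * g k l * g m l).
    under [RHS]eq_bigr => k _ do rewrite mulr_sumr.
    rewrite exchange_big; apply: eq_bigr => l _ /=.
    by rewrite -termE mulr_sumr; apply: eq_bigr => k _; ring.
  by apply: big1 => k _; rewrite path_coord_orthogonal ?mulr0.
rewrite -subr_ge0 -sumrB; under eq_bigr => l _ do rewrite sqrE.
rewrite exchange_big; apply: sumr_ge0 => i _ /=.
(* Above the threshold all terms are nonnegative if [mu i <= t]; otherwise all
   terms below it are nonpositive, and the total vanishes. *)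
have [mut|tmu] := leP (mu i) t.
  apply: sumr_ge0 => l tl; apply: mulr_ge0; last exact: sqr_ge0.
  by rewrite mulr_ge0 ?subr_ge0 // (le_trans mut).
have := total i; rewrite (bigID (fun l => t <= d 0 l)) /= => /eqP.
rewrite addr_eq0 => /eqP ->; rewrite oppr_ge0.
apply: sumr_le0 => l; rewrite -ltNge => lt.
rewrite -mulrA mulr_ge0_le0 // mulr_le0_ge0 ?sqr_ge0 // subr_le0 ltW //.
exact: lt_trans lt tmu.
Qed.

End PendantPath.

(** * Laplacians and edges *)

Section GraphMatrixEdges.
Variables (R : realType) (n : nat).
Implicit Types G H : graph n.

(** The Laplacian for [sg = -1] and the signless Laplacian for [sg = 1]. *)
Definition signed_laplacian (sg : R) G : 'M[R]_n :=
  degree_mx R G + sg *: adjacency_mx R G.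

Definition same_edge (a b i j : 'I_n) :=
  ((i == a) && (j == b)) || ((i == b) && (j == a)).

Definition edge_row (sg : R) (a b : 'I_n) : 'rV[R]_n :=
  delta_mx 0 a + sg *: delta_mx 0 b.

Variable sg : R.

Lemma signed_laplacianE G i j : signed_laplacian sg G i j =
  (i == j)%:R * \sum_k (G i k)%:R + sg * (G i j)%:R.
Proof.
rewrite !mxE; congr (_ + _); rewrite /degree cardsE -sum1_card natr_sum.
rewrite big_mkcond /=; case: eqP => _; rewrite ?mulr1n ?mulr0n ?mul0r // mul1r.
by apply: eq_bigr => k _; rewrite -[k \in G i]/(G i k); case: (G i k).
Qed.

Lemma signed_laplacian_sym G : (signed_laplacian sg G)^T = signed_laplacian sg G.
Proof.
apply/matrixP => i j; rewrite mxE !signed_laplacianE adj_sym eq_sym.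
by case: eqP => [->|_] //; rewrite !mul0r.
Qed.

Lemma signed_laplacian_row G i : delta_mx 0 i *m signed_laplacian sg G =
  \sum_(k | G i k) edge_row sg i k.
Proof.
rewrite -rowE; apply/rowP => j; rewrite mxE signed_laplacianE summxE.
under [RHS]eq_bigr => k _ do rewrite !mxE eqxx /=.
rewrite big_split /= -mulr_sumr; congr (_ + _ * _).
  rewrite mulr_sumr [RHS]big_mkcond eq_sym; apply: eq_bigr => k _.
  by case: (G i k); rewrite ?mulr1 ?mulr0.
rewrite big_mkcond (bigD1 j) //= eqxx big1 ?addr0; first by case: (G i j).
by move=> k /negbTE kj; rewrite eq_sym kj; case: ifP.
Qed.

Lemma signed_laplacian_add_edge G H a b : sg * sg = 1 -> a != b -> ~~ G a b ->
  (forall i j, H i j = G i j || same_edge a b i j) ->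
  signed_laplacian sg H
    = signed_laplacian sg G + (edge_row sg a b)^T *m edge_row sg a b.
Proof.
move=> sg2 ab Gab HE; have ba : b != a by rewrite eq_sym.
have Gba : ~~ G b a by rewrite adj_sym.
have HR i j : (H i j)%:R = (G i j)%:R + (i == a)%:R * (j == b)%:R
                         + (i == b)%:R * (j == a)%:R :> R.
  rewrite HE /same_edge -!natrM -!natrD; congr (_%:R).
  case: (eqVneq i a) => [->|ia]; case: (eqVneq j b) => [->|jb] /=.
  - by rewrite (negbTE Gab) (negbTE ab).
  - by rewrite (negbTE ab) /= orbF mul0n !addn0.
  - by rewrite (negbTE ba) andbF orbF muln0 !addn0.
  case: (eqVneq i b) => [->|ib]; case: (eqVneq j a) => [->|ja] /=;
    by rewrite ?(negbTE Gba) ?orbF ?addn0.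
apply/matrixP => i j; rewrite [RHS]mxE !signed_laplacianE.
rewrite [X in _ = _ + X]mxE big_ord1 !mxE !eqxx /=.
under eq_bigr => k _ do rewrite HR.
have sum1 c : \sum_(k < n) (k == c)%:R = 1 :> R.
  by rewrite (bigD1 c) //= eqxx big1 ?addr0 // => k /negbTE ->.
rewrite !big_split /= -!mulr_sumr !sum1 HR !mulr1.
rewrite [i == j]eq_sym; have [->|ji] := eqVneq j i.
  have [->|_] := eqVneq i a.
    by rewrite (negbTE ab) /=; ring.
  have [_|_] := eqVneq i b; rewrite /=; last by ring.
  by rewrite !add0r !mulr1 sg2; ring.
have [ia|_] := eqVneq i a.
  have [ja|_] := eqVneq j a; first by rewrite ia ja eqxx in ji.
  by rewrite ia (negbTE ab) /=; ring.
have [ib|_] := eqVneq i b; last by rewrite /=; ring.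
have [jb|_] := eqVneq j b; first by rewrite ib jb eqxx in ji.
by rewrite /=; ring.
Qed.

(** The form is half the sum of the squares [(v i + sg * v j) ^ 2] over all
    arcs. *)
Lemma signed_laplacian_quadratic_ge0 G (v : 'rV[R]_n) : sg * sg = 1 ->
  0 <= (v *m signed_laplacian sg G *m v^T) 0 0.
Proof.
move=> sg2.
pose Q := \sum_i \sum_j (G i j)%:R * (v 0 i + sg * v 0 j) ^+ 2.
have Q0 : 0 <= Q.
  by do 2!apply: sumr_ge0 => ? _; rewrite mulr_ge0 ?sqr_ge0 ?ler0n.
suff -> : (v *m signed_laplacian sg G *m v^T) 0 0 = Q / 2.
  by rewrite divr_ge0 ?ler0n.
pose S := \sum_i \sum_j (G i j)%:R * v 0 i ^+ 2.
have SE : S = \sum_i \sum_j (G i j)%:R * v 0 j ^+ 2.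
  rewrite exchange_big; apply: eq_bigr => j _; apply: eq_bigr => i _ /=.
  by rewrite adj_sym.
pose P := \sum_i \sum_j (G i j)%:R * (sg * v 0 i * v 0 j).
have -> : Q = S + S + (P + P).
  rewrite {2}SE /S /P -!big_split; apply: eq_bigr => i _ /=.
  rewrite -!big_split; apply: eq_bigr => j _ /=.
  have -> : (v 0 i + sg * v 0 j) ^+ 2 = v 0 i ^+ 2 + sg * sg * v 0 j ^+ 2 +
    2 * (sg * v 0 i * v 0 j) by ring.
  by rewrite sg2; ring.
have -> : (S + S + (P + P)) / 2 = S + P by field.
rewrite mxE.
under eq_bigr => j _ do rewrite !mxE mulr_suml.
rewrite exchange_big /S /P -big_split; apply: eq_bigr => i _ /=.
under eq_bigr => j _ do rewrite signed_laplacianE mulrDr mulrDl.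
rewrite big_split /=; congr (_ + _); last first.
  by apply: eq_bigr => j _; ring.
rewrite (bigD1 i) //= eqxx [X in _ + X = _]big1 ?addr0; last first.
  by move=> j ji; rewrite eq_sym (negbTE ji) mul0r mulr0 mul0r.
by rewrite mul1r -mulr_suml; ring.
Qed.

Lemma signed_laplacian_eigenvalue_ge0 G U d l : sg * sg = 1 ->
  diagonalizes U d (signed_laplacian sg G) -> 0 <= d 0 l.
Proof.
move=> sg2 [UU ME].
have -> : d 0 l = (row l U *m signed_laplacian sg G *m (row l U)^T) 0 0.
  transitivity ((U *m signed_laplacian sg G *m U^T) l l).
    by rewrite ME !mulmxA UU mul1mx -mulmxA UU mulmx1 mxE eqxx.
  rewrite -row_mul [LHS]mxE [RHS]mxE; apply: eq_bigr => k _.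
  by rewrite !mxE.
exact: signed_laplacian_quadratic_ge0.
Qed.

End GraphMatrixEdges.

(** * Moving an edge to the free end of a pendant path *)

Section MovingAnEdge.
Variables (R : realType) (n : nat).
Implicit Types G : graph n.

(** The indicator of the component of [h], as a diagonal matrix [C], commutes
    with the Laplacian, hence with its spectral projections. *)
Lemma disconnected_projection_entry G (sg : R) U d (h x : 'I_n) t :
  diagonalizes U d (signed_laplacian sg G) -> ~~ connect G h x ->
  \sum_(l | t <= d 0 l) U l h * U l x = 0.
Proof.
move=> [UU ME] hx; have UTU := mulmx1C UU; set M := signed_laplacian _ _ in ME.
pose C : 'M[R]_n := diag_mx (\row_i (connect G h i)%:R).
have CM : C *m M = M *m C.
  apply/matrixP => i j; rewrite mul_diag_mx mul_mx_diag [LHS]mxE [RHS]mxE.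
  rewrite ![(\row_k _) 0 _]mxE mulrC /M signed_laplacianE.
  have [->//|_] := eqVneq i j.
  have [Gij|_] := boolP (G i j); last by rewrite mul0r mulr0 addr0 !mul0r.
  have sym := sym_connect_sym (@adj_sym _ G).
  by rewrite (same_connect_r sym (connect1 Gij)).
have [Ch ChE] : exists Ch, Ch = U *m C *m U^T by exists (U *m C *m U^T).
have ChD : Ch *m diag_mx d = diag_mx d *m Ch.
  have -> : diag_mx d = U *m M *m U^T.
    by rewrite ME !mulmxA UU mul1mx -mulmxA UU mulmx1.
  rewrite ChE !mulmxA -[U *m C *m _ *m _]mulmxA -(mulmxA U C) UTU mulmx1.
  rewrite -[U *m M *m _ *m _]mulmxA UTU mulmx1 -(mulmxA U C) CM.
  by rewrite !mulmxA.
pose P : 'M[R]_n := diag_mx (\row_l (t <= d 0 l)%R%:R).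
have ChP : Ch *m P = P *m Ch.
  apply/matrixP => i j; rewrite mul_diag_mx mul_mx_diag [LHS]mxE [RHS]mxE.
  rewrite ![(\row_k _) 0 _]mxE.
  move/matrixP/(_ i j): ChD; rewrite mul_diag_mx mul_mx_diag [LHS]mxE [RHS]mxE.
  set c := Ch i j => cd.
  have [dij|dij] := eqVneq (d 0 i) (d 0 j); first by rewrite dij mulrC.
  suff -> : c = 0 by rewrite mul0r mulr0.
  apply/eqP; have : c * (d 0 j - d 0 i) = 0.
    by rewrite mulrBr cd mulrC subrr.
  by move/eqP; rewrite mulf_eq0 subr_eq0 [d 0 j == _]eq_sym (negbTE dij) orbF.
pose E := U^T *m P *m U.
have CE : C *m E = E *m C.
  have CU : U^T *m Ch = C *m U^T by rewrite ChE !mulmxA UTU mul1mx.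
  have UC : Ch *m U = U *m C by rewrite ChE -mulmxA UTU mulmx1.
  have -> : C *m E = U^T *m (Ch *m P) *m U by rewrite /E !mulmxA CU.
  by rewrite ChP /E -(mulmxA _ U C) -UC !mulmxA.
have -> : \sum_(l | t <= d 0 l) U l h * U l x = E h x.
  rewrite mxE big_mkcond; apply: eq_bigr => l _.
  rewrite mul_mx_diag !mxE; case: (t <= d 0 l).
    by rewrite mulr1.
  by rewrite mulr0 mul0r.
move/matrixP/(_ h x): CE; rewrite mul_diag_mx mul_mx_diag [LHS]mxE [RHS]mxE.
by rewrite !mxE connect0 (negbTE hx) mul1r mulr0.
Qed.

Lemma delta_coord (U : 'M[R]_n) (i l : 'I_n) :
  ((delta_mx 0 i : 'rV[R]_n) *m U^T) 0 l = U l i.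
Proof. by rewrite -rowE !mxE. Qed.

Lemma orthogonal_col_norm (U : 'M[R]_n) i : U *m U^T = 1%:M ->
  \sum_l U l i ^+ 2 = 1.
Proof.
move=> UU; have UTU : U^T *m U^T^T = 1%:M by rewrite trmxK; apply: mulmx1C.
rewrite -(orthogonal_row_norm i UTU).
by apply: eq_bigr => l _; rewrite mxE.
Qed.

Variables (f f' : R -> R).
Hypothesis f_tangent : forall x y, f x + f' x * (y - x) <= f y.
Hypothesis f'_convex : has_support_lines f'.

(** The spectral measure of an edge from [h] to another component is the sum of
    the measures of its two ends, so only the ends of the path matter. *)
Lemma move_edge_to_pendant_end G (sg : R) (m : nat) (q : nat -> 'I_n) (h : 'I_n) :
    sg = 1 \/ sg = -1 ->
    (forall i j, (i <= m)%N -> (j <= m)%N -> q i = q j -> i = j) ->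
    ((0 < m)%N -> forall j, G (q 0) j = (j == q 1)) ->
    (forall k, (k.+1 < m)%N ->
      forall j, G (q k.+1) j = (j == q k) || (j == q k.+2)) ->
    ~~ connect G h (q 0) -> ~~ connect G h (q m) ->
  spectral_sum f (signed_laplacian sg G +
      (edge_row sg h (q 0))^T *m edge_row sg h (q 0))
    <= spectral_sum f (signed_laplacian sg G +
      (edge_row sg h (q m))^T *m edge_row sg h (q m)).
Proof.
move=> sgP q_inj q_end q_inner h0 hm.
have sg2 : sg * sg = 1 by case: sgP => ->; rewrite ?mulrNN mulr1.
have Msym := signed_laplacian_sym sg G.
have [U UM] := diagonalizable_lambda Msym; have [UU _] := UM.
pose d : 'rV[R]_n := \row_i lambda (signed_laplacian sg G) i.
have dE l : lambda (signed_laplacian sg G) l = d 0 l by rewrite mxE.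
have edge_sqr i l : (edge_row sg h i *m U^T) 0 l ^+ 2 =
    U l h ^+ 2 + U l i ^+ 2 + 2 * sg * (U l h * U l i).
  rewrite mulmxDl -scalemxAl mxE [X in _ + X]mxE !delta_coord.
  have -> : U l i ^+ 2 = sg * sg * U l i ^+ 2 by rewrite sg2 mul1r.
  by ring.
have edge_tail i t : ~~ connect G h i ->
    \sum_(l | t <= d 0 l) (edge_row sg h i *m U^T) 0 l ^+ 2 =
    \sum_(l | t <= d 0 l) U l h ^+ 2 + \sum_(l | t <= d 0 l) U l i ^+ 2.
  move=> hi; under eq_bigr => l _ do rewrite edge_sqr.
  rewrite !big_split /= -mulr_sumr.
  by rewrite (disconnected_projection_entry _ UM hi) mulr0 addr0.
apply: (spectral_sum_dominance f_tangent f'_convex Msym UM) => [|t]; last first.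
  under eq_bigl => l do rewrite dE.
  under [leRHS]eq_bigl => l do rewrite dE.
  rewrite !edge_tail // lerD2l.
  under eq_bigr => l _ do rewrite -delta_coord.
  under [leRHS]eq_bigr => l _ do rewrite -delta_coord.
  apply: (end_tail_le UM (e := fun k => delta_mx 0 (q k)) _ sgP).
  - by move=> l; apply: signed_laplacian_eigenvalue_ge0 UM.
  - move=> i j im jm; rewrite trmx_delta mul_delta_mx_cond.
    have -> : (q i == q j) = (i == j).
      by apply/eqP/eqP => [/q_inj->|->].
    by case: (i == j); apply/matrixP => a b; rewrite !ord1 !mxE.
  - move=> m0; rewrite signed_laplacian_row (big_pred1 (q 1)) // => j.
    exact: q_end.
  move=> k km; rewrite signed_laplacian_row.
  rewrite (bigD1 (q k)) ?q_inner ?eqxx //= (big_pred1 (q k.+2)) => [|j].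
    rewrite /edge_row; apply/rowP => l; rewrite !mxE; ring.
  rewrite /= q_inner //; have [->|] //= := eqVneq j (q k).
    apply/esym/eqP => /q_inj; have km' := ltnW km.
    by move/(_ (ltnW km') km)/eqP; rewrite ltn_eqF.
  by rewrite andbT.
(* Equality of the total masses is the case of a threshold below all
   eigenvalues. *)
have all_t (F : 'I_n -> R) : \sum_l F l =
    \sum_(l | - (\sum_l `|d 0 l|) <= d 0 l) F l.
  apply: eq_bigl => l; apply/esym; rewrite lerNl.
  apply: le_trans (_ : `|d 0 l| <= _); first by rewrite -normrN ler_norm.
  by rewrite (bigD1 l) //= lerDl sumr_ge0.
by rewrite all_t [RHS]all_t !edge_tail // -!all_t !orthogonal_col_norm.
Qed.

End MovingAnEdge.

(** * Reduction of a connected graph to a path *)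

Section ReductionToPath.
Variable n : nat.
Implicit Types G H : graph n.

Lemma same_edge_sym (a b i j : 'I_n) : same_edge a b i j = same_edge a b j i.
Proof. by rewrite /same_edge orbC ![(j == _) && _]andbC. Qed.

Lemma del_edge_sym G a b :
  symmetric [rel i j : 'I_n | G i j && ~~ same_edge a b i j].
Proof. by move=> i j /=; rewrite adj_sym same_edge_sym. Qed.

Lemma del_edge_irr G a b :
  irreflexive [rel i j : 'I_n | G i j && ~~ same_edge a b i j].
Proof. by move=> i /=; rewrite adj_irr. Qed.

Definition del_edge G a b : graph n :=
  Graph (@del_edge_sym G a b) (@del_edge_irr G a b).

Lemma add_edge_sym G a b :
  symmetric [rel i j : 'I_n | G i j || (i != j) && same_edge a b i j].
Proof. by move=> i j /=; rewrite adj_sym same_edge_sym eq_sym. Qed.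

Lemma add_edge_irr G a b :
  irreflexive [rel i j : 'I_n | G i j || (i != j) && same_edge a b i j].
Proof. by move=> i /=; rewrite adj_irr eqxx. Qed.

Definition add_edge G a b : graph n :=
  Graph (@add_edge_sym G a b) (@add_edge_irr G a b).

Lemma graph_connect_sym G : connect_sym G.
Proof. exact/sym_connect_sym/adj_sym. Qed.

Lemma same_edge_refl (a b : 'I_n) : same_edge a b a b.
Proof. by rewrite /same_edge !eqxx. Qed.

Lemma del_edgeN G a b : ~~ del_edge G a b a b.
Proof. by rewrite /= same_edge_refl andbF. Qed.

Lemma del_edgeK G a b : G a b ->
  forall i j, G i j = del_edge G a b i j || same_edge a b i j.
Proof.
move=> Gab i j /=; rewrite orb_andl orNb andbT.
have [/orP[]/andP[/eqP-> /eqP->]|] := boolP (same_edge a b i j).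
- by rewrite Gab.
- by rewrite adj_sym Gab.
by rewrite orbF.
Qed.

Lemma add_edgeE G a b : a != b ->
  forall i j, add_edge G a b i j = G i j || same_edge a b i j.
Proof.
move=> ab i j /=; congr (_ || _); rewrite andb_idl //.
by move=> /orP[]/andP[/eqP-> /eqP->] //; rewrite eq_sym.
Qed.

Definition arc_count G := (\sum_i \sum_j G i j)%N.

Lemma arc_count_add_edge G H a b : a != b -> ~~ G a b ->
  (forall i j, H i j = G i j || same_edge a b i j) ->
  arc_count H = (arc_count G + 2)%N.
Proof.
move=> ab Gab HE.
have sum1 (c c' : 'I_n) : (\sum_i \sum_j ((i == c) && (j == c')) = 1)%N.
  rewrite (bigD1 c) //= (bigD1 c') //= !eqxx big1 ?big1 //.
    by move=> i /negbTE ic; apply: big1 => j _; rewrite ic.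
  by move=> j /negbTE jc; rewrite jc andbF.
transitivity (\sum_i \sum_j (G i j + ((i == a) && (j == b) : nat)
                                   + ((i == b) && (j == a) : nat)))%N.
  apply: eq_bigr => i _; apply: eq_bigr => j _; rewrite HE /same_edge.
  have [/andP[/eqP-> /eqP->]|_] := boolP ((i == a) && (j == b)).
    by rewrite (negbTE Gab) (negbTE ab).
  have [/andP[/eqP-> /eqP->]|_] := boolP ((i == b) && (j == a)).
    by rewrite adj_sym (negbTE Gab).
  by rewrite !orbF !addn0.
under eq_bigr => i _ do rewrite !big_split.
by rewrite !big_split /= !sum1 -addnA.
Qed.

(** The vertices [q 0, ..., q m] are distinct and consecutive ones adjacent. A
    function on all of [nat] avoids bounds proofs in the indices. *)
Definition simple_path G m (q : nat -> 'I_n) :=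
  (forall i j, (i <= m)%N -> (j <= m)%N -> q i = q j -> i = j) /\
  (forall k, (k < m)%N -> G (q k) (q k.+1)).

Lemma simple_path_lt G m q : simple_path G m q -> (m < n)%N.
Proof.
move=> [q_inj _]; have := @leq_card _ _ (fun i : 'I_m.+1 => q i).
rewrite !card_ord; apply=> i j /q_inj ij; apply: val_inj.
by apply: ij; rewrite -ltnS.
Qed.

Lemma chain_connect (e : rel 'I_n) (q : nat -> 'I_n) i k : (i <= k)%N ->
  (forall t, (i <= t < k)%N -> e (q t) (q t.+1)) -> connect e (q i) (q k).
Proof.
elim: k => [|k IHk]; first by rewrite leqn0 => /eqP->.
rewrite leq_eqVlt => /predU1P[->//|]; rewrite ltnS => ik eq.
apply: connect_trans (connect1 (eq k _)); last by rewrite ik /=.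
by apply: IHk => // t /andP[it tk]; apply: eq; rewrite it ltnW.
Qed.

(** A chord closes a cycle with the part of the path between its ends, so it is
    not a bridge. *)
Lemma chord_connect G m q i k : simple_path G m q ->
  (i.+1 < k)%N -> (k <= m)%N -> connect (del_edge G (q i) (q k)) (q i) (q k).
Proof.
move=> [q_inj q_edge] ik km; apply: chain_connect => [|t /andP[it tk]].
  exact/ltnW/ltnW.
have tm := leq_trans tk km.
rewrite /= q_edge //=; apply/norP; split; apply/negP => /andP[/eqP qt /eqP qt1].
  have := q_inj _ _ (ltnW tm) (leq_trans (ltnW (ltnW ik)) km) qt => ti.
  have := q_inj _ _ tm km qt1 => tk1.
  by move: ik; rewrite -ti -tk1 ltnn.
have := q_inj _ _ (ltnW tm) km qt => tk1.
by rewrite tk1 ltnn in tk.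
Qed.

Variables (R : realType) (f f' : R -> R).
Hypothesis f_tangent : forall x y, f x + f' x * (y - x) <= f y.
Hypothesis f'_ge0 : forall x, 0 <= f' x.
Hypothesis f'_convex : has_support_lines f'.
Variable sg : R.
Hypothesis sg_sign : sg = 1 \/ sg = -1.
Local Notation Psi G := (spectral_sum f (signed_laplacian sg G)).

Lemma spectral_sum_relabel G H (s : 'S_n) :
  (forall i j, H i j = G (s i) (s j)) -> Psi H = Psi G.
Proof.
move=> HG; pose P : 'M[R]_n := perm_mx s.
have PP : P^T *m P^T^T = 1%:M.
  by rewrite trmxK tr_perm_mx -perm_mxM mulVg perm_mx1.
rewrite -(spectral_sum_orthogonal f (signed_laplacian_sym sg G) PP) trmxK.
congr (spectral_sum f _); rewrite tr_perm_mx -row_permE -col_permE.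
apply/matrixP => i j; rewrite [RHS]mxE [RHS]mxE !signed_laplacianE HG.
rewrite (inj_eq perm_inj); congr (_ * _ + _).
rewrite [RHS](reindex_inj (@perm_inj _ s)) /=.
by apply: eq_bigr => k _; rewrite HG.
Qed.

(** If the vertices of the path have no further neighbours, they form a
    component, which is the whole graph. *)
Lemma spanning_path_relabel G m q : connected G -> simple_path G m q ->
  (forall i h, (i <= m)%N -> G (q i) h ->
     ((0 < i)%N /\ h = q i.-1) \/ ((i < m)%N /\ h = q i.+1)) ->
  Psi G = Psi (path_graph n).
Proof.
move=> [_ Gconn] qP nbr; have [q_inj q_edge] := qP.
have cover v : exists2 i, (i <= m)%N & v = q i.
  pose S := [pred v | [exists i : 'I_m.+1, v == q i]].
  have S_closed : closed G S.
    apply: (intro_closed (@graph_connect_sym G)) => x y Gxy.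
    move=> /existsP[[i im]]/= /eqP xq; apply/existsP.
    rewrite xq in Gxy; have [[i0 ->]|[im' ->]] := nbr _ _ im Gxy.
      by exists (Ordinal (leq_ltn_trans (leq_pred i) im)).
    by exists (Ordinal (im' : (i.+1 < m.+1)%N)).
  have : v \in S.
    rewrite -(closed_connect S_closed (Gconn (q 0) v)).
    by apply/existsP; exists ord0.
  by move=> /existsP[i /eqP->]; exists i; rewrite // -ltnS.
have mn : m.+1 = n.
  apply/eqP; rewrite eqn_leq (simple_path_lt qP) /=.
  have -> : m.+1 = #|[set: 'I_m.+1]| by rewrite cardsT card_ord.
  rewrite -[X in (X <= _)%N]card_ord -cardsT.
  have <- : (fun i : 'I_m.+1 => q i) @: [set: 'I_m.+1] = [set: 'I_n].
    apply/setP => v; rewrite inE; have [i im ->] := cover v.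
    by apply/imsetP; exists (Ordinal (im : (i < m.+1)%N)).
  exact: leq_imset_card.
have ordm (i : 'I_n) : (i <= m)%N by rewrite -ltnS mn.
have s_inj : injective (fun i : 'I_n => q i).
  by move=> i j /q_inj ij; apply/val_inj/ij.
symmetry; apply: (@spectral_sum_relabel _ _ (perm s_inj)) => i j.
rewrite !permE /= /path_rel /=; apply/idP/idP.
  case/orP => /eqP ji; rewrite ji; first by rewrite q_edge // -ltnS mn -ji.
  by rewrite adj_sym q_edge // -ltnS mn -ji.
move=> Gij; have [[i0 /q_inj ji]|[im /q_inj ji]] := nbr _ _ (ordm i) Gij.
  by rewrite ji ?(leq_trans (leq_pred i)) // prednK ?eqxx ?orbT.
by rewrite ji ?eqxx.
Qed.

Lemma spectral_sum_del_edge G a b : G a b -> Psi (del_edge G a b) <= Psi G.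
Proof.
move=> Gab; have sg2 : sg * sg = 1 by case: sg_sign => ->; rewrite ?mulrNN mulr1.
have ab : a != b by apply: contraTneq Gab => ->; rewrite adj_irr.
rewrite [leRHS](_ : _ = spectral_sum f (signed_laplacian sg (del_edge G a b) +
  (edge_row sg a b)^T *m edge_row sg a b)); last first.
  by rewrite -(signed_laplacian_add_edge sg2 ab (del_edgeN G a b) (del_edgeK Gab)).
apply: (spectral_sum_add_rank_one f_tangent f'_ge0).
exact: signed_laplacian_sym.
Qed.

Lemma del_edge_connected G a b : connected G ->
  connect (del_edge G a b) a b -> connected (del_edge G a b).
Proof.
move=> [n0 Gconn] ab; split=> // i j; move: i j (Gconn i j).
apply: connect_sub => i j Gij.
have [|nab] := boolP (same_edge a b i j); last first.
  by apply: connect1; rewrite /= Gij.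
by case/orP => /andP[/eqP-> /eqP->] //; rewrite graph_connect_sym.
Qed.

(** In a graph all of whose edges are bridges, [h] is off the path, as a chord
    would not be a bridge. Replacing the edge from [q i] to [h] by one from
    [q 0] to [h] prolongs the path by [h], and [q 0, ..., q i] is a pendant path
    of the graph without either edge. *)
Lemma move_branch G m q i h : connected G -> simple_path G m q ->
    (forall a b, G a b -> ~~ connect (del_edge G a b) a b) ->
    (i <= m)%N -> G (q i) h ->
    ((0 < i)%N -> h != q i.-1) -> ((i < m)%N -> h != q i.+1) ->
    (forall k g, (k < i)%N -> G (q k) g ->
      ((0 < k)%N /\ g = q k.-1) \/ g = q k.+1) ->
  exists H q', [/\ connected H, simple_path H m.+1 q',
    arc_count H = arc_count G & Psi H <= Psi G].
Proof.
move=> Gconn qP bridge im Gqh hpred hsucc nbr; have [q_inj q_edge] := qP.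
have sg2 : sg * sg = 1 by case: sg_sign => ->; rewrite ?mulrNN mulr1.
have Ghq : G h (q i) by rewrite adj_sym.
have h_off k : (k <= m)%N -> h != q k.
  move=> km; apply/eqP => hq.
  have [ki|ik|ki] := ltngtP k i; last by rewrite hq ki adj_irr in Gqh.
  - have [k1i|] := ltnP k.+1 i.
      have := bridge (q k) (q i); rewrite adj_sym -hq => /(_ Gqh)/negP; apply.
      by rewrite hq; apply: chord_connect qP _ _.
    rewrite leq_eqVlt ltnNge ki orbF => /eqP ik.
    have /negP[] := hpred (leq_ltn_trans (leq0n k) ki).
    by rewrite ik /= hq.
  have [i1k|] := ltnP i.+1 k.
    by have /negP[] := bridge _ _ Gqh; rewrite hq; apply: chord_connect qP _ _.
  rewrite leq_eqVlt ltnNge ik orbF => /eqP ki.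
  by have /negP[] := hsucc (leq_trans ik km); rewrite -ki hq.
pose G0 := del_edge G h (q i).
have G0_row k j : (k <= m)%N -> k != i -> G0 (q k) j = G (q k) j.
  move=> km ki; rewrite /= /same_edge [q k == h]eq_sym (negbTE (h_off k km)) /=.
  have -> : (q k == q i) = false; last by rewrite andbT.
  by apply: contraNF ki => /eqP/q_inj->.
have G0_edge k : (k < m)%N -> G0 (q k) (q k.+1).
  move=> km; have [ki|ki] := eqVneq k i; last by rewrite G0_row ?q_edge // ltnW.
  by rewrite adj_sym G0_row -?ki ?gtn_eqF // adj_sym q_edge.
have G0_0i : connect G0 (q 0) (q i).
  apply: chain_connect => // t /andP[_ ti].
  exact/G0_edge/(leq_trans ti).
have Nhi : ~~ connect G0 h (q i) by apply: bridge.
have Nh0 : ~~ connect G0 h (q 0).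
  by apply: contra Nhi => h0; apply: connect_trans h0 G0_0i.
have hq0 := h_off 0 (leq0n m); have hqi := h_off i im.
have NG0 : ~~ G0 h (q 0) by apply: contra Nh0; apply: connect1.
pose H := add_edge G0 h (q 0); have HE := add_edgeE G0 hq0.
have Hh0 : H h (q 0) by rewrite HE same_edge_refl orbT.
have Hqq k : (k < m)%N -> H (q k) (q k.+1) by move=> km; rewrite HE G0_edge.
exists H, (fun k => if k is k'.+1 then q k' else h); split.
- have [n0 Gc] := Gconn; split=> // a b; move: a b (Gc a b).
  have G0H : subrel (connect G0) (connect H).
    by apply: connect_sub => a b ab; apply: connect1; rewrite HE ab.
  have Hhi : connect H h (q i).
    exact: connect_trans (connect1 Hh0) (G0H _ _ G0_0i).
  apply: connect_sub => a b; rewrite (del_edgeK Ghq) => /orP[ab|].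
    by apply: G0H; apply: connect1.
  by case/orP => /andP[/eqP-> /eqP->] //; rewrite graph_connect_sym.
- split=> [[|a] [|b]|[|k]] //; rewrite ?ltnS.
  + by move=> _ bm hb; have := h_off b bm; rewrite hb eqxx.
  + by move=> am _ ha; have := h_off a am; rewrite ha eqxx.
  + by move=> am bm /q_inj->.
  exact: Hqq.
- rewrite (arc_count_add_edge hq0 NG0 HE).
  by rewrite -(arc_count_add_edge hqi (del_edgeN _ _ _) (del_edgeK Ghq)).
rewrite (signed_laplacian_add_edge sg2 hq0 NG0 HE).
rewrite (signed_laplacian_add_edge sg2 hqi (del_edgeN _ _ _) (del_edgeK Ghq)).
apply: move_edge_to_pendant_end => //.
- move=> a b ai bi; apply: q_inj; first exact: leq_trans ai im.
  exact: leq_trans bi im.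
- move=> i0 j; rewrite G0_row ?ltn_eqF //; apply/idP/eqP => [Gj|->].
    by have [[]|] := nbr _ _ i0 Gj.
  exact/q_edge/(leq_trans i0).
move=> k ki j; have km := leq_trans ki im.
rewrite G0_row ?ltn_eqF ?(ltnW km) //; apply/idP/orP => [Gj|].
  by have [[_ ->]|->] := nbr _ _ ki Gj; rewrite eqxx; [left|right].
by case=> /eqP->; rewrite ?q_edge // adj_sym q_edge // ltnW.
Qed.

(** The induction decreases the number of edges or, for the same number of
    edges, increases the length of a simple path; the factor [n + 1] lets a
    deletion restart from a path with one vertex. *)
Lemma spectral_sum_path_le G : connected G -> Psi (path_graph n) <= Psi G.
Proof.
suff main N m q : connected G -> simple_path G m q ->
    (arc_count G * n.+1 + (n - m) < N)%N -> Psi (path_graph n) <= Psi G.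
  move=> Gconn; have [n0 _] := Gconn.
  pose q0 (_ : nat) := Ordinal n0.
  apply: (main (arc_count G * n.+1 + (n - 0)).+1 0 q0 Gconn) => //.
  by split=> // i j; rewrite !leqn0 => /eqP-> /eqP->.
elim: N G m q => [//|N IHN] G m q Gconn qP; rewrite ltnS => GN.
have mn := simple_path_lt qP; have [q_inj q_edge] := qP.
have [/existsP[a /existsP[b /andP[Gab ab]]]|nobridge] := boolP
    [exists a, exists b, G a b && connect (del_edge G a b) a b].
  apply: le_trans (spectral_sum_del_edge Gab).
  apply: (IHN _ 0 (fun=> a)) => //.
  - exact: del_edge_connected.
  - by split=> // i j; rewrite !leqn0 => /eqP-> /eqP->.
  have neq : a != b by apply: contraTneq Gab => ->; rewrite adj_irr.
  apply: leq_trans GN.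
  rewrite (arc_count_add_edge neq (del_edgeN G a b) (del_edgeK Gab)).
  rewrite subn0 mulnDl -addnA ltn_add2l mul2n -addnn -addnA.
  by rewrite addSn ltnS leq_addr.
have bridge a b : G a b -> ~~ connect (del_edge G a b) a b.
  move=> Gab; apply: contra nobridge => ab.
  by apply/existsP; exists a; apply/existsP; exists b; rewrite Gab.
pose off i h := [&& G (q i) h, (0 < i)%N ==> (h != q i.-1)
                              & (i < m)%N ==> (h != q i.+1)].
pose branch i := (i <= m)%N && [exists h, off i h].
have [/existsP[i0 bi0]|nobranch] := boolP [exists i : 'I_m.+1, branch i];
    last first.
  rewrite (spanning_path_relabel Gconn qP) // => i h im Gh.
  move: nobranch; rewrite negb_exists => /forallP/(_ (Ordinal (im : (i < m.+1)%N))).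
  rewrite /branch /= im negb_exists => /forallP/(_ h).
  rewrite /off Gh /= negb_and !negb_imply !andbT.
  by case/orP => /andP[ii /eqP->]; [left|right].
have [i /andP[im /existsP[h /and3P[Gh hp hs]]] imin] := ex_minnP (ex_intro branch _ bi0).
have [|H [q' [Hconn q'P HG PsiHG]]] := move_branch Gconn qP bridge im Gh
    (implyP hp) (implyP hs).
  move=> k g ki Gg; have km := leq_trans ki im.
  have : ~~ branch k by apply: contraL ki => /imin; rewrite -leqNgt.
  rewrite /branch (ltnW km) /= negb_exists => /forallP/(_ g).
  rewrite /off Gg /= km /= negb_and negb_imply !negbK => /orP[/andP[k0 /eqP->]|/eqP->].
    by left.
  by right.
apply: le_trans PsiHG; apply: IHN Hconn q'P _.
by rewrite HG; apply: leq_trans GN; rewrite ltn_add2l ltn_sub2l.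
Qed.

End ReductionToPath.

(** * Powers of the positive part *)

Section PositivePartPower.
Variable R : realType.

(** Young's inequality for [u `^ (q - 1)] and [v]. *)
Lemma powR_tangent (q u v : R) : 1 <= q -> 0 <= u -> 0 <= v ->
  u `^ q + q * u `^ (q - 1) * (v - u) <= v `^ q.
Proof.
move=> q1 u0 v0; have [->|q_neq1] := eqVneq q 1.
  by rewrite subrr powRr0 !powRr1 // !mul1r addrC subrK.
have q_gt1 : 1 < q by rewrite lt_neqAle eq_sym q_neq1.
have q_gt0 : 0 < q by apply: lt_trans q_gt1.
have qB1 : 0 < q - 1 by rewrite subr_gt0.
have q_conjugate : (q / (q - 1))^-1 + q^-1 = 1.
  by rewrite invf_div -[X in _ + X]mul1r -mulrDl subrK divff // gt_eqF.
have := conjugate_powR (powR_ge0 u (q - 1)) v0 (divr_gt0 q_gt0 qB1) q_gt0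
  q_conjugate.
rewrite -powRrM [(q - 1) * _]mulrC divfK ?gt_eqF // invf_div => young.
have := ler_wpM2l (ltW q_gt0) young.
have -> : q * (u `^ q * ((q - 1) / q) + v `^ q / q) =
          (q - 1) * u `^ q + v `^ q by field; rewrite gt_eqF.
have -> : q * u `^ (q - 1) * (v - u) =
          q * (u `^ (q - 1) * v) - q * (u * u `^ (q - 1)) by ring.
by rewrite mulr_powRB1 //; lra.
Qed.

Lemma pos_pow_le0 (q x : R) : q != 0 -> x <= 0 -> pos_pow x q = 0.
Proof. by move=> q0 x0; rewrite /pos_pow max_r // powR0. Qed.

Lemma pos_pow_ge0 (q x : R) : 0 <= pos_pow x q.
Proof. exact: powR_ge0. Qed.

Lemma pos_pow_tangent_gt0 (q x y : R) : 1 <= q -> 0 < x ->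
  pos_pow x q + q * pos_pow x (q - 1) * (y - x) <= pos_pow y q.
Proof.
move=> q1 x0; rewrite /pos_pow (max_l (ltW x0)).
have y0 : 0 <= Num.max y 0 by rewrite le_max lexx orbT.
apply: le_trans (powR_tangent q1 (ltW x0) y0).
rewrite lerD2l ler_wpM2l ?mulr_ge0 ?powR_ge0 ?(le_trans ler01) //.
by rewrite lerD2r le_max lexx.
Qed.

Lemma pos_pow_tangent (q x y : R) : 1 < q ->
  pos_pow x q + q * pos_pow x (q - 1) * (y - x) <= pos_pow y q.
Proof.
move=> q1; have [x0|x0] := leP x 0; last exact: pos_pow_tangent_gt0 (ltW q1) x0.
have q0 : 0 < q by apply: lt_trans q1.
rewrite !(pos_pow_le0 _ x0) ?gt_eqF ?subr_gt0 //.
by rewrite mulr0 mul0r addr0 pos_pow_ge0.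
Qed.

Lemma pos_pow_support_lines (a q c : R) : 1 <= q -> 0 <= c ->
  has_support_lines (fun x => c * pos_pow (x - a) q).
Proof.
move=> q1 c0 x; have [x0|x0] := leP (x - a) 0.
  exists 0 => y; rewrite mul0r addr0 (pos_pow_le0 _ x0).
    by rewrite mulr0 mulr_ge0 // pos_pow_ge0.
  by rewrite gt_eqF // (lt_le_trans ltr01).
exists (c * (q * pos_pow (x - a) (q - 1))) => y.
have := ler_wpM2l c0 (pos_pow_tangent_gt0 (y - a) q1 x0).
by lra.
Qed.

End PositivePartPower.

Theorem corollary3p13 (R : realType) (n : nat) (G : graph n)
    (G_connected : connected G) (a p : R) (a_ge0 : 0 <= a) (p_ge2 : 2 <= p) :
  \sum_(i < n) pos_pow (lambda (laplacian R G) i - a) p >=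
    \sum_(i < n) pos_pow (lambda (laplacian R (path_graph n)) i - a) p
  /\
  \sum_(i < n) pos_pow (lambda (signless_laplacian R G) i - a) p >=
    \sum_(i < n) pos_pow (lambda (signless_laplacian R (path_graph n)) i - a) p.
Proof.
have p_gt1 : 1 < p by apply: lt_le_trans p_ge2; rewrite ltr1n.
have p_ge0 : 0 <= p by rewrite ltW // (lt_trans ltr01).
have p1_ge1 : 1 <= p - 1 by rewrite lerBrDr.
pose f x := pos_pow (x - a) p; pose f' x := p * pos_pow (x - a) (p - 1).
have f_tangent x y : f x + f' x * (y - x) <= f y.
  by have := pos_pow_tangent (x - a) (y - a) p_gt1; rewrite opprB addrA subrK.
have f'_ge0 x : 0 <= f' x by rewrite mulr_ge0 // pos_pow_ge0.
have f'_convex : has_support_lines f' by apply: pos_pow_support_lines.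
(* The derivative [f'] is convex because its exponent [p - 1] is at least 1. *)
have path_le sg := spectral_sum_path_le f_tangent f'_ge0 f'_convex (sg := sg).
have LE H : laplacian R H = signed_laplacian (-1) H :> 'M[R]_n.
  by rewrite /signed_laplacian scaleN1r.
have QE H : signless_laplacian R H = signed_laplacian 1 H :> 'M[R]_n.
  by rewrite /signed_laplacian scale1r.
split; [rewrite !LE|rewrite !QE]; apply: path_le => //; [by right|by left].
Qed.
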